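(* For every $\epsilon>0$ there exist constants $C_\epsilon>0$ and $C_0=C_0(\epsilon)>0$ such that the following holds. For every positive integer $N$ and every real $A\ge N^{C_0}$ there exists a set of vectors $V=V_{N,\epsilon}\subset\{z\in\mathbb{Z}^2:\ |z|\approx A\}$ with $|V|=N$, and there exists a (sufficiently large) constant $C_1=C_1(A)$, such that for every integer $k$ with $2^k\ge N^{C_1}$, $$\|A_{V,k}\|_{\ell^2(\mathbb{Z}^2)\to\ell^2(\mathbb{Z}^2)}\le C_\epsilon\, N^{\epsilon}.$$
   Context: Let $\phi$ be a fixed bump function on $\mathbb{R}$ (smooth, compactly supported), and let $\phi_k(t):=2^{-k}\phi(2^{-k}t)$. Constants may depend on $\phi$ (they are uniform over suitably normalized bump functions). For a finite set $V\subset\mathbb{Z}^2$ and $f:\mathbb{Z}^2\to\mathbb{C}$ define $$A_{V,k}f(x):=\sup_{v\in V}\Big|\sum_{n\in\mathbb{Z}}f(x-nv)\,\phi_k(n)\Big|,\qquad x\in\mathbb{Z}^2 .$$ The norm $\|T\|_{\ell^2(\mathbb{Z}^2)\to\ell^2(\mathbb{Z}^2)}$ of such a sublinear operator $T$ is the least $C$ with $\|Tf\|_{\ell^2(\mathbb{Z}^2)}\le C\|f\|_{\ell^2(\mathbb{Z}^2)}$ for all $f\in \ell^2(\mathbb{Z}^2)$. The notation $|z|\approx A$ means $c_1A\le|z|\le c_2A$ for absolute constants $0<c_1<c_2$ (independent of $\epsilon$, $N$, $A$). The constant $C_1(A)$ may also depend on $\epsilon$. *)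

(* Defs.v *)
From mathcomp Require Import all_boot all_order all_algebra finmap complex.
From mathcomp Require Import all_classical all_reals all_analysis.

Set Implicit Arguments.
Unset Strict Implicit.
Unset Printing Implicit Defensive.

Import Order.TTheory GRing.Theory Num.Theory.
Import numFieldNormedType.Exports.

Local Open Scope classical_set_scope.
Local Open Scope ring_scope.

Definition smooth (R : realType) (phi : R -> R) :=
  forall (n : nat) (x : R), derivable (derive1n n phi) x 1.

Definition bump_function (R : realType) (phi : R -> R) :=
  smooth phi /\ compact (closure [set t | phi t != 0]).

Definition dilate (R : realType) (phi : R -> R) (k : int) (t : R) : R :=
  2 ^ (- k) * phi (2 ^ (- k) * t).

Definition Z2norm (R : realType) (z : int * int) : R :=
  Num.sqrt (z.1%:~R ^+ 2 + z.2%:~R ^+ 2).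

(* The sum over n is a finitely supported one, which is the actual sum as soon
   as phi has compact support. *)
Definition directional_average (R : realType) (phi : R -> R) (k : int)
    (v : int * int) (f : int * int -> R[i]) (x : int * int) : R[i] :=
  \sum_(n \in [set: int]) f (x - v *~ n) * (dilate phi k n%:~R)%:C%C.

(* The value is a nonnegative real, embedded in R[i] so that the operator acts
   on complex-valued functions. *)
Definition directional_maximal (R : realType) (phi : R -> R)
    (V : {fset int * int}) (k : int) (f : int * int -> R[i])
    (x : int * int) : R[i] :=
  (sup [set Normc.normc (directional_average phi k v f x) | v in [set` V]])%:C%C.

Definition l2norm (R : realType) (f : int * int -> R[i]) : \bar R :=
  sqrte (\esum_(x in [set: int * int]) ((Normc.normc (f x)) ^+ 2)%:E).

Definition l2 (R : realType) : set (int * int -> R[i]) :=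
  [set f | (l2norm f < +oo)%E].

(* The infimum is +oo when T is unbounded. *)
Definition l2_opnorm (R : realType)
    (T : (int * int -> R[i]) -> (int * int -> R[i])) : \bar R :=
  ereal_inf [set C%:E | C in
    [set C : R | forall f, l2 f -> (l2norm (T f) <= C%:E * l2norm f)%E]].

(* Main.v *)
Require Import Defs.
From mathcomp Require Import all_boot all_order all_algebra finmap complex.
From mathcomp Require Import all_classical all_reals all_analysis.
From mathcomp Require Import ring lra zify.

(** The set is [V = {(1, j0), ..., (1, j0 + N - 1)}] with [j0] just above [A].

    Linearise the supremum by a choice [j(x)] of direction and fix the first
    coordinate of [x].  The TT* kernel counts the [n] with
    [x - n j(x) = y - n j(y)]: for [d = |j(x) - j(y)| > 0] there is at most one,
    and it forces [d | x - y] and [|x - y| <= L d], where [L ~ 2^k].  All terms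
    being nonnegative, one may sort by the dyadic size [2^i] of [d], cut the line
    into blocks of length [~ L 2^i] and replace 1 by [d / 2^i]; this costs a
    factor [log N] and leaves the kernel [d 1_(d | x - y)], which is the TT*
    kernel of the maximal function over all the lines of slope [w < N] in the
    plane over the finite group [Z/M], [M = (N-1)!].

    There the [l^(2s)] norm over the slopes is 2-uniformly smooth.  Split [F]
    into its average over a larger group of vertical translations (period [m / q]
    instead of [m], with [q] prime, [q^k] exactly dividing [m]) and a rest.
    Smoothness adds the squared norms with a constant [c0 = c0(s)] on the rest
    only.  On the rest, the averages along the directions of distinct slopes
    mod [q^k] are mutually orthogonal, so the slopes may be treated one residue
    class mod [q^k] at a time.  Hence the constant of a set [U] of slopes is
    the maximum of its constant for [m / q] and of [c0] times the constants of
    the classes.  For large [q] the factor [c0] is absorbed by the small size of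
    the classes; on a branch of the recursion each prime is used at most once,
    so that the primes below a threshold cost a constant.  When all slopes of [U]
    agree mod [m] the constant is [#|U|^(1/s)], which is the only loss. *)

Set Implicit Arguments.
Unset Strict Implicit.
Unset Printing Implicit Defensive.
Import Order.TTheory GRing.Theory Num.Theory.
Import numFieldNormedType.Exports.
Local Open Scope ring_scope.

(** * Power norms *)

Section ScalarInequalities.
Variable R : realFieldType.
Implicit Types (a b x y r : R) (s n : nat).

(** Induction on the exponent: since [a + b = 1], the defect at each step is a b (x^s - y^s)(x - y),
    nonnegative by monotonicity. *)
Lemma exprn_convex a b x y s : 0 <= a -> 0 <= b -> a + b = 1 -> 0 <= x -> 0 <= y ->
  (a * x + b * y) ^+ s <= a * x ^+ s + b * y ^+ s.
Proof.
move=> a0 b0 ab x0 y0; elim: s => [|s IH].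
  by rewrite !expr0 !mulr1 ab.
have xy0 : 0 <= (x ^+ s - y ^+ s) * (x - y).
  have [xy|yx] := leP x y.
    by apply: mulr_le0; rewrite subr_le0 // lerXn2r ?nnegrE.
  by apply: mulr_ge0; rewrite subr_ge0 ?lerXn2r ?nnegrE // ltW.
rewrite exprSr.
apply: (le_trans (ler_wpM2r _ IH)); first by rewrite addr_ge0 // mulr_ge0.
rewrite -subr_ge0 !exprSr.
have -> : a * (x ^+ s * x) + b * (y ^+ s * y)
    - (a * x ^+ s + b * y ^+ s) * (a * x + b * y)
  = a * b * ((x ^+ s - y ^+ s) * (x - y)).
  have -> : b = 1 - a by rewrite -ab addrC addKr.
  by ring.
by rewrite mulr_ge0 // mulr_ge0.
Qed.

(** A Taylor bound with explicit quadratic remainder; adding it at r and -r in [two_point] cancels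
    the linear terms. *)
Lemma expr_1D_le r n : 0 <= 1 + r -> n%:R * `|r| <= 1 ->
  (1 + r) ^+ n <= 1 + n%:R * r + (n%:R * r) ^+ 2.
Proof.
move=> r1; elim: n => [|n IH] h; first by rewrite !mul0r expr0 expr0n /= !addr0.
have h' : n%:R * `|r| <= 1.
  by apply: le_trans h; rewrite ler_wpM2r // ler_nat.
rewrite exprSr; apply: (le_trans (ler_wpM2r r1 (IH h'))).
rewrite -subr_ge0 -[n.+1]addn1 natrD.
have nr : n%:R * r <= 1 by apply: le_trans h'; rewrite ler_wpM2l // ler_norm.
have -> : 1 + (n%:R + 1) * r + ((n%:R + 1) * r) ^+ 2
   - (1 + n%:R * r + (n%:R * r) ^+ 2) * (1 + r)
  = r ^+ 2 * (1 + n%:R * (1 - n%:R * r)) by ring.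
by rewrite mulr_ge0 ?sqr_ge0 // addr_ge0 // mulr_ge0 // subr_ge0.
Qed.

(** A 2-uniform smoothness constant for l^(2s). The base 2s + 1 is what |x| + |y| costs in terms of
    |y| when |x| <= 2s |y|. *)
Definition smooth_const s : R := (s.*2.+1%:R) ^+ 2.

(** If |x| <= 2s |y|, the [y]-term alone dominates both powers. Otherwise divide by [x]: the
    second-order bound applies at r = y / x and at -r, and Bernoulli's inequality bounds the
    right-hand side from below. *)
Lemma two_point x y s :
  (x + y) ^+ (s.*2) + (x - y) ^+ (s.*2) <=
  2 * (x ^+ 2 + smooth_const s * y ^+ 2) ^+ s.
Proof.
have even (u : R) : u ^+ s.*2 = (u ^+ 2) ^+ s by rewrite -exprM mul2n.
have [xy|yx] := leP `|x| (s.*2%:R * `|y|).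
  have bnd (u : R) : `|u| <= s.*2.+1%:R * `|y| ->
      u ^+ s.*2 <= (x ^+ 2 + smooth_const s * y ^+ 2) ^+ s.
    move=> hu; rewrite even lerXn2r ?nnegrE ?sqr_ge0 //.
      by rewrite addr_ge0 ?sqr_ge0 // mulr_ge0 ?sqr_ge0.
    rewrite -[u ^+ 2]ger0_norm ?sqr_ge0 // normrX.
    apply: (le_trans (y := (s.*2.+1%:R * `|y|) ^+ 2)).
      by rewrite lerXn2r ?nnegrE ?mulr_ge0.
    by rewrite exprMn /smooth_const -normrX (ger0_norm (sqr_ge0 y)) lerDr sqr_ge0.
  rewrite mulr_natl mulr2n lerD // bnd //.
    by apply: (le_trans (ler_normD _ _)); rewrite -[s.*2.+1]addn1 natrD mulrDl mul1r lerD2r.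
  by apply: (le_trans (ler_normB _ _)); rewrite -[s.*2.+1]addn1 natrD mulrDl mul1r lerD2r.
have x0 : x != 0.
  by rewrite -normr_gt0; apply: le_lt_trans yx; rewrite mulr_ge0.
pose r := y / x.
have yE : y = r * x by rewrite /r divfK.
have hr : s.*2%:R * `|r| <= 1.
  by rewrite /r normrM normfV mulrA ler_pdivrMr ?normr_gt0 // mul1r ltW.
move: r yE hr => r yE hr.
have one (z : R) : `|z| = `|r| -> (1 + z) ^+ s.*2 <= 1 + s.*2%:R * z + (s.*2%:R * z) ^+ 2.
  move=> zr; case: (posnP s) => [->|s0].
    by rewrite double0 !mul0r expr0 expr0n /= !addr0.
  apply: expr_1D_le; last by rewrite zr.
  have : `|z| <= 1.
    rewrite zr; apply: le_trans hr; rewrite ler_peMl // ler1n.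
    by rewrite double_gt0.
  by rewrite ler_norml => /andP[? _]; rewrite -lerBlDl sub0r.
have -> : x + y = (1 + r) * x by rewrite yE; ring.
have -> : x - y = (1 - r) * x by rewrite yE; ring.
have -> : x ^+ 2 + smooth_const s * y ^+ 2 = (1 + smooth_const s * r ^+ 2) * x ^+ 2.
  by rewrite yE; ring.
rewrite [((1 + r) * x) ^+ _]exprMn [((1 - r) * x) ^+ _]exprMn [(_ * x ^+ 2) ^+ s]exprMn.
rewrite (even x) -mulrDl [leRHS]mulrA; apply: ler_wpM2r.
  by apply/exprn_ge0/sqr_ge0.
have bern : 1 + s%:R * (smooth_const s * r ^+ 2) <= (1 + smooth_const s * r ^+ 2) ^+ s.
  have : 0 <= smooth_const s * r ^+ 2 by rewrite mulr_ge0 ?sqr_ge0.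
  move: (smooth_const s * _) => u u0.
  elim: s {yx hr even one} => [|n IH]; first by rewrite mul0r addr0 expr0.
  rewrite exprSr; apply: le_trans (ler_wpM2r _ IH); last by rewrite addr_ge0.
  rewrite -subr_ge0 -addn1 natrD.
  have -> : (1 + n%:R * u) * (1 + u) - (1 + (n%:R + 1) * u) = n%:R * u ^+ 2 by ring.
  by rewrite mulr_ge0 ?sqr_ge0.
have h1 := one r erefl; have h2 := one (- r) (normrN r).
apply: (le_trans (lerD h1 h2)).
apply: le_trans (ler_wpM2l _ bern) => //.
rewrite -subr_ge0 /smooth_const.
have -> : 2 * (1 + s%:R * (s.*2.+1%:R ^+ 2 * r ^+ 2)) -
  (1 + s.*2%:R * r + (s.*2%:R * r) ^+ 2 +
   (1 + s.*2%:R * - r + (s.*2%:R * - r) ^+ 2)) =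
   2 * r ^+ 2 * (s%:R * s.*2.+1%:R ^+ 2 - s.*2%:R ^+ 2).
  by ring.
apply: mulr_ge0; first by rewrite pmulr_rge0 // sqr_ge0.
rewrite -!natrX -natrM subr_ge0 ler_nat.
case: s {yx hr even one bern h1 h2} => // n.
by apply: leq_trans (leq_pmull _ _); rewrite // leq_sqr.
Qed.

End ScalarInequalities.

Section PowerNorm.
Variables (R : realType) (W : finType) (s : nat).
Hypothesis s0 : (0 < s)%N.
Implicit Types (U : {set W}) (u v : W -> R).

(** Meant for squares: its value at u^2 is the squared l^(2s) norm of u over [U]. *)
Definition pnorm U u : R := (\sum_(w in U) u w ^+ s) `^ (s%:R^-1).

Let sR0 : s%:R != 0 :> R. Proof. by rewrite pnatr_eq0 -lt0n. Qed.

Lemma pnorm_ge0 U u : 0 <= pnorm U u.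
Proof. exact: powR_ge0. Qed.

Lemma pnormX U u : (forall w, 0 <= u w) -> pnorm U u ^+ s = \sum_(w in U) u w ^+ s.
Proof.
move=> u0; rewrite -powR_mulrn ?pnorm_ge0 // /pnorm -powRrM mulVf // powRr1 //.
by apply: sumr_ge0 => w _; rewrite exprn_ge0.
Qed.

Lemma pnorm_le U u a : (forall w, 0 <= u w) -> 0 <= a ->
  (\sum_(w in U) u w ^+ s <= a ^+ s) -> pnorm U u <= a.
Proof.
move=> u0 a0 h; rewrite -(@ler_pXn2r _ s) ?nnegrE ?pnorm_ge0 //.
by rewrite pnormX.
Qed.

Lemma eq_pnorm U u v : {in U, u =1 v} -> pnorm U u = pnorm U v.
Proof. by move=> uv; rewrite /pnorm; congr powR; apply: eq_bigr => w /uv ->. Qed.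

Lemma pnorm_mono U u v : (forall w, 0 <= u w) -> {in U, forall w, u w <= v w} ->
  (forall w, 0 <= v w) -> pnorm U u <= pnorm U v.
Proof.
move=> u0 uv v0; apply: pnorm_le => //; first exact: pnorm_ge0.
rewrite pnormX //; apply: ler_sum => w wU.
by rewrite lerXn2r ?nnegrE ?uv.
Qed.

Lemma pnormZ U a u : 0 <= a -> (forall w, 0 <= u w) ->
  pnorm U (fun w => a * u w) = a * pnorm U u.
Proof.
move=> a0 u0; apply: (@pexpIrn _ s) => //.
- by rewrite nnegrE pnorm_ge0.
- by rewrite nnegrE mulr_ge0 ?pnorm_ge0.
rewrite exprMn !pnormX //; last by move=> w; rewrite mulr_ge0.
by rewrite mulr_sumr; apply: eq_bigr => w _; rewrite exprMn.
Qed.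

Lemma le_pnorm U u w : (forall w, 0 <= u w) -> w \in U -> u w <= pnorm U u.
Proof.
move=> u0 wU; rewrite -(@ler_pXn2r _ s) ?nnegrE ?pnorm_ge0 // pnormX //.
by rewrite (bigD1 w) //= lerDl sumr_ge0 // => i _; rewrite exprn_ge0.
Qed.

Lemma pnorm_const U a : 0 <= a -> pnorm U (fun=> a) = (#|U|%:R `^ s%:R^-1) * a.
Proof.
move=> a0; apply: (@pexpIrn _ s) => //.
- by rewrite nnegrE pnorm_ge0.
- by rewrite nnegrE mulr_ge0 ?powR_ge0.
rewrite exprMn pnormX // -(powR_mulrn _ (powR_ge0 _ _)) -powRrM mulVf // powRr1 //.
by rewrite sumr_const mulr_natl.
Qed.

(** Minkowski from convexity: the normalised sum is a convex combination of the normalised summands,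
    with weights a / (a + b) and b / (a + b). Summands of norm zero are treated first, since
    normalising divides by the norms. *)
Lemma pnormD U u v : (forall w, 0 <= u w) -> (forall w, 0 <= v w) ->
  pnorm U (fun w => u w + v w) <= pnorm U u + pnorm U v.
Proof.
move=> u0 v0.
have uv0 w : 0 <= u w + v w by rewrite addr_ge0.
have zero z : (forall w, 0 <= z w) -> pnorm U z = 0 -> {in U, forall w, z w = 0}.
  by move=> z0 zz w wU; apply/eqP; rewrite eq_le z0 andbT -zz le_pnorm.
have [/eqP a0|a0] := boolP (pnorm U u == 0).
  rewrite a0 add0r (@eq_pnorm U _ v) // => w wU.
  by rewrite (zero _ u0 a0) // add0r.
have [/eqP b0|b0] := boolP (pnorm U v == 0).
  rewrite b0 addr0 (@eq_pnorm U _ u) // => w wU.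
  by rewrite (zero _ v0 b0) // addr0.
move: a0 b0; set a := pnorm U u; set b := pnorm U v => a0 b0.
have {}a0 : 0 < a by rewrite lt_def a0 pnorm_ge0.
have {}b0 : 0 < b by rewrite lt_def b0 pnorm_ge0.
have ab : 0 < a + b by rewrite addr_gt0.
apply: pnorm_le => //; first exact: ltW.
rewrite -[leRHS]mulr1 -ler_pdivrMl ?exprn_gt0 // mulr_sumr.
have -> : 1 = a / (a + b) * (a ^- s * \sum_(w in U) u w ^+ s)
            + b / (a + b) * (b ^- s * \sum_(w in U) v w ^+ s).
  rewrite -!pnormX // -/a -/b !mulVf ?expf_neq0 ?gt_eqF // !mulr1 -mulrDl.
  by rewrite divff // gt_eqF.
rewrite !mulr_sumr -big_split /=; apply: ler_sum => w _.
rewrite -exprVn -exprMn.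
have -> : (a + b)^-1 * (u w + v w) = a / (a + b) * (a^-1 * u w) + b / (a + b) * (b^-1 * v w).
  by field; rewrite !gt_eqF.
rewrite -!exprVn -!exprMn; apply: exprn_convex; rewrite ?mulr_ge0 ?invr_ge0 // ?ltW //.
by rewrite -mulrDl divff // gt_eqF.
Qed.

Lemma pnorm_sum (I : Type) (r : seq I) (P : pred I) U (F : I -> W -> R) :
  (forall i w, 0 <= F i w) ->
  pnorm U (fun w => \sum_(i <- r | P i) F i w) <= \sum_(i <- r | P i) pnorm U (F i).
Proof.
move=> F0; elim: r => [|i r IH].
  rewrite big_nil (@eq_pnorm U _ (fun=> 0)) => [|w _]; last by rewrite big_nil.
  by rewrite pnorm_const // mulr0.
rewrite big_cons; case: ifP => Pi; last first.
  by rewrite (eq_pnorm (v := fun w => \sum_(j <- r | P j) F j w)) // => w _; rewrite big_cons Pi.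
apply: le_trans (lerD (lexx _) IH).
apply: le_trans (pnormD _ _ _) => //; last by move=> w; apply: sumr_ge0.
by apply: pnorm_mono => w; rewrite ?big_cons ?Pi // addr_ge0 // sumr_ge0.
Qed.

(** Triangle inequality for the restrictions of [u] to the [V i], whose sum dominates [u] on [U]. *)
Lemma pnorm_cover (I : finType) U (V : I -> {set W}) u : (forall w, 0 <= u w) ->
  (forall w, w \in U -> exists i, w \in V i) ->
  pnorm U u <= \sum_i pnorm (V i) u.
Proof.
move=> u0 UV; pose F i w := if w \in V i then u w else 0.
have F0 i w : 0 <= F i w by rewrite /F; case: ifP.
apply: (@le_trans _ _ (pnorm U (fun w => \sum_i F i w))).
  apply: pnorm_mono => // [w wU|w]; last exact: sumr_ge0.
  have [i wi] := UV w wU; rewrite (bigD1 i) //= {1}/F wi lerDl.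
  exact: sumr_ge0.
apply: (le_trans (pnorm_sum _ _ _ F0)); apply: ler_sum => i _.
apply: pnorm_le => //; first exact: pnorm_ge0.
rewrite pnormX //; rewrite [leRHS]big_mkcond [leLHS]big_mkcond /=.
apply: ler_sum => w _; rewrite /F; case: ifP => _; case: ifP => _ //.
  by rewrite expr0n gtn_eqF.
by rewrite exprn_ge0.
Qed.

(** Convexity of the s-th power handles the mean on the left, the scalar inequality is summed over
    [U], and Minkowski splits the right-hand side. *)
Lemma pnorm_two_point U (x y : W -> R) :
  pnorm U (fun w => (x w + y w) ^+ 2) + pnorm U (fun w => (x w - y w) ^+ 2) <=
  2 * (pnorm U (fun w => x w ^+ 2) + smooth_const R s * pnorm U (fun w => y w ^+ 2)).
Proof.
set a := pnorm U (fun w => (x w + y w) ^+ 2).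
set b := pnorm U (fun w => (x w - y w) ^+ 2).
have sq (z : W -> R) w : 0 <= z w ^+ 2 by exact: sqr_ge0.
have C0 : 0 <= smooth_const R s by exact: sqr_ge0.
pose c := pnorm U (fun w => x w ^+ 2 + smooth_const R s * y w ^+ 2).
have pos w : 0 <= x w ^+ 2 + smooth_const R s * y w ^+ 2.
  by rewrite addr_ge0 ?sqr_ge0 // mulr_ge0 ?sqr_ge0.
apply: (@le_trans _ _ (2 * c)); last first.
  rewrite ler_pM2l // -pnormZ //.
  by apply: pnormD => // w; apply: mulr_ge0.
rewrite -ler_pdivrMl // mulrDr.
rewrite -(@ler_pXn2r _ s) ?nnegrE ?addr_ge0 ?mulr_ge0 ?pnorm_ge0 ?invr_ge0 //.
apply: (@le_trans _ _ (2^-1 * a ^+ s + 2^-1 * b ^+ s)).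
  by apply: exprn_convex; rewrite ?pnorm_ge0 ?invr_ge0 //; lra.
rewrite -mulrDr ler_pdivrMl // !pnormX //; try by move=> w; exact: sqr_ge0.
rewrite -big_split mulr_sumr /=; apply: ler_sum => w _.
by rewrite -!exprM mul2n; exact: two_point.
Qed.

End PowerNorm.

(** * Averages over finite groups *)

(** Lagrange's identity: the double sum of (a_i b_j - a_j b_i)^2 is twice the defect. *)
Lemma cauchy_schwarz (R : realFieldType) (I : Type) (r : seq I) (P : pred I) (a b : I -> R) :
  (\sum_(i <- r | P i) a i * b i) ^+ 2 <=
  (\sum_(i <- r | P i) a i ^+ 2) * (\sum_(i <- r | P i) b i ^+ 2).
Proof.
set A := \sum_(i <- r | P i) a i ^+ 2; set B := \sum_(i <- r | P i) b i ^+ 2.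
set S := \sum_(i <- r | P i) a i * b i.
have E i : \sum_(j <- r | P j) (a i * b j - a j * b i) ^+ 2 =
    a i ^+ 2 * B - 2 * S * (a i * b i) + b i ^+ 2 * A.
  rewrite /A /B /S !mulr_sumr mulr_suml -sumrB -big_split /=.
  by apply: eq_bigr => j _; ring.
have : 0 <= \sum_(i <- r | P i) \sum_(j <- r | P j) (a i * b j - a j * b i) ^+ 2.
  by do 2!apply: sumr_ge0 => ? _; exact: sqr_ge0.
under eq_bigr do rewrite E.
rewrite big_split sumrB -mulr_sumr -!mulr_suml -/A -/B -/S /=.
by move=> h; nra.
Qed.

Section FiniteGroup.
Variables (R : realType) (G : finZmodType).
Implicit Types (F H : G -> G -> R) (c d m w : nat) (n z t : G).

Definition inner F H : R := \sum_n \sum_z F n z * H n z.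
Definition normsq F : R := \sum_n \sum_z F n z ^+ 2.
Definition line_sum w F z : R := \sum_n F n (z + n *+ w).
(** The conditional expectation onto the functions invariant under all translations by (t c, t d),
    with t in [G]. *)
Definition group_avg c d F n z : R :=
  #|G|%:R^-1 * \sum_t F (n + t *+ c) (z + t *+ d).
Definition periodic m F := forall n z t, F n (z + t *+ m) = F n z.

Let G0 : #|G|%:R != 0 :> R.
Proof. by rewrite pnatr_eq0 -lt0n; apply/card_gt0P; exists (0 : G). Qed.

Let Gi0 : 0 <= #|G|%:R^-1 :> R. Proof. by rewrite invr_ge0 ler0n. Qed.

Lemma sum_shift (u : G) (f : G -> R) : \sum_t f (t + u) = \sum_t f t.
Proof. by rewrite [RHS](reindex_inj (addIr u)). Qed.

Lemma sum_cst (a : R) : \sum_(t : G) a = #|G|%:R * a.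
Proof. by rewrite sumr_const mulr_natl. Qed.

Lemma normsq_ge0 F : 0 <= normsq F.
Proof. by do 2!apply: sumr_ge0 => ? _; exact: sqr_ge0. Qed.

Lemma normsqE F : normsq F = inner F F.
Proof. by []. Qed.

Lemma innerC F H : inner F H = inner H F.
Proof. by do 2!apply: eq_bigr => ? _; rewrite mulrC. Qed.

Lemma eq_inner F F' H : (forall n z, F n z = F' n z) -> inner F H = inner F' H.
Proof. by move=> FF; do 2!apply: eq_bigr => ? _; rewrite FF. Qed.

Lemma group_avg_shift c d F n z t :
  group_avg c d F (n + t *+ c) (z + t *+ d) = group_avg c d F n z.
Proof.
rewrite /group_avg -(sum_shift t (fun t => F (n + t *+ c) (z + t *+ d))).
by congr (_ * _); apply: eq_bigr => u _; rewrite !mulrnDl !addrA -!(addrAC _ (t *+ _)).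
Qed.

Lemma group_avg_idem c d F n z :
  group_avg c d (group_avg c d F) n z = group_avg c d F n z.
Proof.
rewrite {1}/group_avg; under eq_bigr do rewrite group_avg_shift.
by rewrite sum_cst mulKf.
Qed.

Lemma group_avgB c d F H n z :
  group_avg c d (fun n z => F n z - H n z) n z = group_avg c d F n z - group_avg c d H n z.
Proof. by rewrite /group_avg sumrB mulrBr. Qed.

Lemma inner_group_avg c d F H : inner (group_avg c d F) H = inner F (group_avg c d H).
Proof.
pose S F H := \sum_t \sum_n \sum_z F (n + t *+ c) (z + t *+ d) * H n z.
have SE F1 H1 : inner (group_avg c d F1) H1 = #|G|%:R^-1 * S F1 H1.
  rewrite /inner /S [in RHS]exchange_big mulr_sumr /=; apply: eq_bigr => n _.
  rewrite [in RHS]exchange_big mulr_sumr /=; apply: eq_bigr => z _.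
  by rewrite -mulr_suml mulrA.
rewrite SE [RHS]innerC SE; congr (_ * _).
rewrite /S [RHS](reindex_inj oppr_inj) /=; apply: eq_bigr => t _.
rewrite -[LHS](sum_shift (- (t *+ c))); apply: eq_bigr => n _.
rewrite -[LHS](sum_shift (- (t *+ d))); apply: eq_bigr => z _.
by rewrite !subrK !mulNrn mulrC.
Qed.

Lemma normsq_group_avg c d F : normsq (group_avg c d F) = inner F (group_avg c d F).
Proof.
rewrite normsqE inner_group_avg innerC [RHS]innerC.
by apply: eq_inner => n z; exact: group_avg_idem.
Qed.

(** Pythagoras: the averaging is self-adjoint and idempotent, hence an orthogonal projection. *)
Lemma normsq_split c d F :
  normsq F = normsq (group_avg c d F) + normsq (fun n z => F n z - group_avg c d F n z).
Proof.
have -> : normsq (fun n z => F n z - group_avg c d F n z) =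
    normsq F - 2 * inner F (group_avg c d F) + normsq (group_avg c d F).
  rewrite /normsq /inner mulr_sumr -sumrB -big_split /=; apply: eq_bigr => n _.
  rewrite mulr_sumr -sumrB -big_split /=; apply: eq_bigr => z _; ring.
by rewrite normsq_group_avg; ring.
Qed.

Lemma periodic_congr m F n z t x y : periodic m F -> x = y %[mod m] ->
  F n (z + t *+ x) = F n (z + t *+ y).
Proof.
move=> Fm xy.
have red u : F n (z + t *+ u) = F n (z + t *+ (u %% m)).
  by rewrite {1}(divn_eq u m) mulrnDr mulrnA addrA addrAC Fm.
by rewrite red xy -red.
Qed.

Lemma line_sum_congr m F w w' z : periodic m F -> w = w' %[mod m] ->
  line_sum w F z = line_sum w' F z.
Proof. by move=> Fm ww; apply: eq_bigr => n _; exact: periodic_congr ww. Qed.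

Lemma periodic_group_avg m c d F : periodic m F -> periodic m (group_avg c d F).
Proof.
by move=> Fm n z t; congr (_ * _); apply: eq_bigr => u _; rewrite addrAC Fm.
Qed.

Lemma periodic_group_avg0 m F : periodic m (group_avg 0 m F).
Proof.
by move=> n z t; rewrite -[RHS](group_avg_shift _ _ _ _ _ t) mulr0n addr0.
Qed.

(** Cauchy-Schwarz on each line costs [#|G|], and the lines of one slope partition the plane. *)
Lemma line_sum_sq w F : \sum_z line_sum w F z ^+ 2 <= #|G|%:R * normsq F.
Proof.
apply: (@le_trans _ _ (\sum_z #|G|%:R * \sum_n F n (z + n *+ w) ^+ 2)).
  apply: ler_sum => z _.
  have := cauchy_schwarz (index_enum G) xpredT (fun=> 1) (fun n => F n (z + n *+ w)).
  rewrite (eq_bigr (fun n => F n (z + n *+ w))) => [|n _]; last by rewrite mul1r.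
  rewrite (eq_bigr (fun=> 1) (F1 := fun=> 1 ^+ 2)) => [|n _]; last by rewrite expr1n.
  by rewrite sumr_const.
rewrite -mulr_sumr ler_wpM2l // exchange_big le_eqVlt; apply/orP; left; apply/eqP.
apply: eq_bigr => n _.
exact: (sum_shift (n *+ w) (fun z => F n z ^+ 2)).
Qed.

Lemma sum_line_sum w m F z :
  \sum_t line_sum w F (z + t *+ m) = #|G|%:R * line_sum w (group_avg 0 m F) z.
Proof.
rewrite /line_sum exchange_big mulr_sumr /=; apply: eq_bigr => n _.
rewrite /group_avg mulVKf //; apply: eq_bigr => t _.
by rewrite mulr0n addr0 addrAC.
Qed.

(** Translating by (t c, t a c) moves a line of slope [w] along itself up to a vertical multiple of
    the period, so it only permutes the terms of the line sum. *)
Lemma line_sum_group_avg m c a w F z : periodic m F -> w * c = a * c %[mod m] ->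
  line_sum w (group_avg c (a * c) F) z = line_sum w F z.
Proof.
move=> Fm wa; rewrite /line_sum /group_avg -mulr_sumr exchange_big /=.
rewrite (eq_bigr (fun=> line_sum w F z)) => [|t _].
  by rewrite sum_cst mulKf.
rewrite /line_sum -[RHS](sum_shift (t *+ c)); apply: eq_bigr => n _.
rewrite -(periodic_congr _ _ _ Fm wa) mulrnDl -mulrnA addrA.
by rewrite mulnC.
Qed.

(* By Bezout, a function on [G] invariant under [e] and [m] is invariant under [m']. *)
Lemma sum_eq0_gcd m m' e H n z : periodic m H ->
  (forall n z, group_avg 0 m' H n z = 0) -> (0 < e)%N -> (gcdn e m %| m')%N ->
  \sum_t H n (z + t *+ e) = 0.
Proof.
move=> Hm Hm' e0 gm'; pose phi z := \sum_t H n (z + t *+ e).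
have phie u v : phi (v + u *+ e) = phi v.
  rewrite /phi -[RHS](sum_shift u); apply: eq_bigr => t _.
  by rewrite mulrnDl addrA addrAC.
have phim u v : phi (v + u *+ m) = phi v.
  by apply: eq_bigr => t _; rewrite addrAC Hm.
have [x [y xy]] : exists x y, (x * e = y * m + m')%N.
  case: (egcdnP m e0) => km kn E _; case/dvdnP: gm' => q ->.
  by exists (q * km)%N, (q * kn)%N; rewrite -mulnA E mulnDr mulnA.
have phim' u v : phi (v + u *+ m') = phi v.
  rewrite -(phim (u *+ y)) -addrA -mulrnA -mulrnDr addnC -xy mulrnA.
  exact: phie.
suff : #|G|%:R * phi z = 0 by move/eqP; rewrite mulf_eq0 (negPf G0) => /eqP.
rewrite -sum_cst (eq_bigr _ (fun u _ => esym (phim' u z))) /phi exchange_big /=.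
apply: big1 => t _; have /eqP := Hm' n (z + t *+ e).
rewrite /group_avg mulf_eq0 invr_eq0 (negPf G0) => /eqP avg0.
rewrite -[RHS]avg0; apply: eq_bigr => u _.
by rewrite mulr0n addr0 addrAC.
Qed.

(** The product of the two projections averages also over vertical translations by multiples of (a -
    b) c. Together with the period [m] these generate the translations by multiples of [m'], over
    which [H] has mean zero. *)
Lemma inner_group_avg_eq0 m m' c a b H : (b < a)%N -> periodic m H ->
  (forall n z, group_avg 0 m' H n z = 0) -> (0 < c)%N -> (gcdn ((a - b) * c) m %| m')%N ->
  inner (group_avg c (a * c) H) (group_avg c (b * c) H) = 0.
Proof.
move=> ba Hm Hm' c0 gm'.
suff PP n z : group_avg c (a * c) (group_avg c (b * c) H) n z = 0.
  rewrite inner_group_avg innerC (eq_inner (F' := fun _ _ => 0)) //.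
  by rewrite /inner big1 // => n _; rewrite big1 // => z _; rewrite mul0r.
have e0 : (0 < (a - b) * c)%N by rewrite muln_gt0 subn_gt0 ba.
rewrite /group_avg -mulr_sumr.
rewrite (eq_bigr (fun t => \sum_r H (n + r *+ c)
    (z + r *+ (b * c) + t *+ ((a - b) * c)))) => [|t _].
  rewrite exchange_big big1 ?mulr0 // => r _.
  exact: (sum_eq0_gcd _ _ Hm).
rewrite -[RHS](sum_shift t); apply: eq_bigr => r _.
rewrite !mulrnDl mulnBl mulrnBr ?leq_mul2r ?(ltnW ba) ?orbT //.
congr (H _ _); first by rewrite addrA addrAC.
by rewrite -!addrA; congr (_ + _); rewrite [t *+ (b * c) + _]addrC subrK addrC.
Qed.

(** Bessel's inequality for the [q ^ k] directions, along which the averages of [H] are pairwise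
    orthogonal. *)
Lemma normsq_group_avg_sum m m' c q k H : prime q -> (0 < k)%N -> (0 < c)%N ->
  m = (q ^ k * c)%N -> m' = (q ^ k.-1 * c)%N -> periodic m H ->
  (forall n z, group_avg 0 m' H n z = 0) ->
  \sum_(a < q ^ k) normsq (group_avg c (a * c) H) <= normsq H.
Proof.
move=> pq k0 c0 mE m'E Hm Hm'; pose P (a : nat) := group_avg c (a * c) H.
have orth (a b : 'I_(q ^ k)) : (b < a)%N -> inner (P a) (P b) = 0.
  move=> ba; apply: (inner_group_avg_eq0 ba Hm Hm') => //.
  rewrite mE m'E -muln_gcdl dvdn_pmul2r //.
  (* As 0 < a - b < q^k, the gcd of a - b and q^k is q^i with i < k, hence divides q^(k-1). *)
  have := dvdn_gcdr (a - b) (q ^ k); case/(dvdn_pfactor _ _ pq) => i ik gi.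
  rewrite gi dvdn_exp2l // -ltnS prednK // ltn_neqAle ik andbT; apply/eqP => iE.
  have := dvdn_gcdl (a - b) (q ^ k); rewrite gi iE.
  by rewrite gtnNdvd ?subn_gt0 // (leq_ltn_trans (leq_subr _ _)).
set S := \sum_a _.
have S0 : 0 <= S by apply: sumr_ge0 => a _; exact: normsq_ge0.
(* Both <H, F> and |F|^2 equal S, so that 0 <= |H - F|^2 reads S <= |H|^2. *)
pose F n z := \sum_(a < q ^ k) P a n z.
have HF : inner H F = S.
  rewrite /S; under [RHS]eq_bigr do rewrite normsq_group_avg.
  rewrite /inner [RHS]exchange_big /=; apply: eq_bigr => n _.
  rewrite [RHS]exchange_big /=; apply: eq_bigr => z _.
  by rewrite mulr_sumr.
have FF : normsq F = S.
  rewrite normsqE; transitivity (\sum_(a < q ^ k) \sum_(b < q ^ k) inner (P a) (P b)).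
    rewrite /inner; under [RHS]eq_bigr do rewrite exchange_big /=.
    rewrite [RHS]exchange_big /=; apply: eq_bigr => n _.
    under [RHS]eq_bigr do rewrite exchange_big /=.
    rewrite [RHS]exchange_big /=; apply: eq_bigr => z _.
    by rewrite /F mulr_suml; apply: eq_bigr => a _; rewrite mulr_sumr.
  apply: eq_bigr => a _; rewrite (bigD1 a) //= big1 ?addr0 // => b ba.
  have [ab|ab|/val_inj ab] := ltngtP a b; last by rewrite ab eqxx in ba.
    by rewrite innerC orth.
  by rewrite orth.
have : 0 <= normsq (fun n z => H n z - F n z).
  exact: normsq_ge0.
suff -> : normsq (fun n z => H n z - F n z) = normsq H - 2 * inner H F + normsq F.
  by rewrite HF FF => h; lra.
rewrite /normsq /inner mulr_sumr -sumrB -big_split /=; apply: eq_bigr => n _.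
rewrite mulr_sumr -sumrB -big_split /=; apply: eq_bigr => z _; ring.
Qed.

End FiniteGroup.

(** * The maximal function over a finite group *)

Section SmoothStep.
Variables (R : realType) (G : finZmodType) (W : finType) (s : nat).
Hypothesis s0 : (0 < s)%N.
Local Notation pnorm := (pnorm s).

(* Ball-Carlen-Lieb 2-smoothness of l^(2s), with the averaging over [m G] in the
   role of the conditional expectation: the coefficient of the [X]-term is 1. *)
Lemma smooth_step (m : nat) (U : {set W}) (X Y : W -> G -> R) :
  (forall w z t, X w (z + t *+ m) = X w z) ->
  (forall w z, \sum_t Y w (z + t *+ m) = 0) ->
  \sum_z pnorm U (fun w => (X w z + Y w z) ^+ 2) <=
  \sum_z pnorm U (fun w => X w z ^+ 2) +
  2 * smooth_const R s * \sum_z pnorm U (fun w => Y w z ^+ 2).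
Proof.
move=> Xm Ym.
have g0 : 0 < #|G|%:R :> R by rewrite ltr0n; apply/card_gt0P; exists (0 : G).
(* [X] is the average of [X - Y] over [m G], so the difference term of the two-point inequality is
   at least the [X]-term; subtracting it lowers the coefficient of the latter from 2 to 1. *)
have jensen : \sum_z pnorm U (fun w => X w z ^+ 2) <=
    \sum_z pnorm U (fun w => (X w z - Y w z) ^+ 2).
  pose Q (z : G) := pnorm U (fun w => (X w z - Y w z) ^+ 2).
  have -> : \sum_z pnorm U (fun w => (X w z - Y w z) ^+ 2) =
      \sum_z #|G|%:R^-1 * \sum_t Q (z + t *+ m).
    rewrite -mulr_sumr exchange_big /= [in RHS](eq_bigr (fun=> \sum_z Q z)) => [|t _].
      by rewrite sum_cst mulKf // gt_eqF.
    exact: sum_shift.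
  apply: ler_sum => z _; rewrite mulrC ler_pdivlMr // mulrC.
  apply: le_trans (pnorm_sum s0 _ _ _ _); last by move=> t w; exact: sqr_ge0.
  rewrite -pnormZ // => [|w]; last exact: sqr_ge0.
  apply: pnorm_mono => // [w|w _|w]; first by rewrite mulr_ge0 ?sqr_ge0.
    rewrite -(ler_pM2l g0) mulrA -expr2 -exprMn.
    have -> : #|G|%:R * X w z = \sum_t 1 * (X w (z + t *+ m) - Y w (z + t *+ m)).
      under eq_bigr do rewrite mul1r Xm.
      by rewrite sumrB Ym subr0 sum_cst.
    apply: (le_trans (cauchy_schwarz _ _ _ _)).
    by under eq_bigr do rewrite expr1n; rewrite sum_cst mulr1.
  by apply: sumr_ge0 => t _; exact: sqr_ge0.
have two : \sum_z (pnorm U (fun w => (X w z + Y w z) ^+ 2) +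
      pnorm U (fun w => (X w z - Y w z) ^+ 2)) <=
    \sum_z 2 * (pnorm U (fun w => X w z ^+ 2) +
      smooth_const R s * pnorm U (fun w => Y w z ^+ 2)).
  by apply: ler_sum => z _; exact: pnorm_two_point.
move: two; rewrite big_split -mulr_sumr big_split -mulr_sumr /=.
lra.
Qed.

Lemma smooth_const_ge1 : 1 <= smooth_const R s.
Proof. by rewrite /smooth_const -natrX ler1n expn_gt0. Qed.

End SmoothStep.

(** * Counting slopes in residue classes *)

Section ResidueClasses.
Variable N : nat.

Definition residue_class (n w0 : nat) := [set w : 'I_N | w == w0 %[mod n]].

Lemma card_residue_class n w0 : (0 < n)%N ->
  #|residue_class n w0| = ((N + n - 1 - w0 %% n) %/ n)%N.
Proof.
move=> n0; have rn := ltn_pmod w0 n0.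
have -> : #|residue_class n w0| = (\sum_(w < N) (w == w0 %[mod n]))%N.
  by rewrite -sum1dep_card big_mkcond.
elim: N => [|M IH]; first by rewrite big_ord0 divn_small //; lia.
rewrite big_ord_recr /= IH {IH}; set r := (w0 %% n)%N in rn *.
have -> : (M.+1 + n - 1 - r = (M + n - 1 - r).+1)%N by lia.
rewrite divnS // addnC; congr (_ + _)%N.
have -> : (M + n - 1 - r).+1 = (M + n - r)%N by lia.
congr nat_of_bool; rewrite -eqn_mod_dvd; last by lia.
by rewrite modnDr modn_mod.
Qed.

(** A class mod [n * q] with u > 1 members spans a length (u - 1) n q, so the class mod [n] has at
    least (u - 1) q + 1 members; moreover u <= 2 (u - 1). *)
Lemma card_residue_class_split n q w0 : (0 < n)%N -> (0 < q)%N ->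
  (1 < #|residue_class (n * q) w0|)%N ->
  (q * #|residue_class (n * q) w0| <= 2 * #|residue_class n w0|)%N.
Proof.
move=> n0 q0; rewrite !card_residue_class ?muln_gt0 ?n0 //.
set P := (N + _ - 1 - _)%N; set u := (P %/ _)%N => u1.
have hu : (u * (n * q) <= P)%N by rewrite leq_divM.
have := modn_dvdm w0 (dvdn_mulr q (dvdnn n)).
have : (w0 %% (n * q) < n * q)%N by rewrite ltn_pmod // muln_gt0 n0.
set r := (w0 %% (n * q))%N => rlt rE.
have rn : (w0 %% n <= r)%N by rewrite -rE leq_mod.
have uE : (u * (n * q) = (u - 1) * q * n + n * q)%N.
  by rewrite -{1}(subnK (ltnW u1)) mulnDl mul1n mulnA mulnAC.
have hu1 : ((u - 1) * q * n + n <= N + n - 1 - w0 %% n)%N.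
  have aux A B b d : (A + B <= N + B - 1 - b -> b < B -> d <= b ->
      A + n <= N + n - 1 - d)%N by clear; lia.
  by apply: (aux _ (n * q)%N r) => //; rewrite -uE.
have h2 : ((u - 1) * q + 1 <= (N + n - 1 - w0 %% n) %/ n)%N.
  by rewrite leq_divRL // mulnDl mul1n.
apply: leq_trans (leq_mul (leqnn 2) h2).
have aux v : (1 < v -> v <= 2 * (v - 1))%N by clear; lia.
rewrite mulnDr mulnA [(2 * _ * q)%N]mulnC; apply: leq_trans (leq_addr _ _).
by rewrite leq_mul2l aux ?orbT.
Qed.

Lemma residue_class_sub n d w0 : (d %| n)%N ->
  residue_class n w0 \subset residue_class d w0.
Proof.
move=> dn; apply/fintype.subsetP => w; rewrite !inE => /eqP e.
by rewrite -(modn_dvdm w dn) e modn_dvdm.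
Qed.

Lemma residue_classI n q w0 a w1 : coprime n q ->
  w1 \in residue_class n w0 -> (w1 = a %[mod q])%N ->
  residue_class n w0 :&: residue_class q a = residue_class (n * q) w1.
Proof.
move=> cnq; rewrite inE => /eqP w10 w1a; apply/finset.setP => w.
by rewrite !inE -w10 -w1a -chinese_remainder.
Qed.

End ResidueClasses.

(** * Recursion over the primes of the period *)

Section FiniteMaximal.
Variables (R : realType) (G : finZmodType) (N s q0 : nat) (theta : R).
Hypothesis s0 : (0 < s)%N.
Hypothesis theta0 : 0 <= theta.
Hypothesis q0P : 2 * smooth_const R s <= (q0%:R / 2) `^ theta.

Let c0 : R := 2 * smooth_const R s.

Let c01 : 1 <= c0.
Proof. by have := smooth_const_ge1 R s; rewrite /c0; lra. Qed.

Definition small_primes (m : nat) := count (fun q => (q < q0)%N) (primes m).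

(** The constant for [u] slopes, [m] being the part of the period that may still separate them. One
    slope costs 1. Otherwise each prime below [q0] may pay a factor [c0], one more such factor
    covers a drop to a single slope, u^theta absorbs the primes from [q0] on, and N^(1/s) is the
    loss at the end. *)
Definition class_bound (m u : nat) : R :=
  if (u <= 1)%N then 1
  else c0 ^+ (small_primes m).+1 * u%:R `^ theta * N%:R `^ s%:R^-1.

Lemma small_primes_dvd d m : (0 < m)%N -> (d %| m)%N -> (small_primes d <= small_primes m)%N.
Proof.
move=> m0 dm; rewrite /small_primes -!size_filter; apply: uniq_leq_size.
  by rewrite filter_uniq ?primes_uniq.
move=> q; rewrite !mem_filter !mem_primes => /and4P[-> -> _ qd] /=.
by rewrite m0 (dvdn_trans qd dm).
Qed.

Lemma small_primes_coprime q d m : prime q -> (q < q0)%N -> coprime q d ->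
  (0 < m)%N -> (q * d %| m)%N -> (small_primes d < small_primes m)%N.
Proof.
move=> pq qq0 cqd m0 dm; rewrite /small_primes -!size_filter.
rewrite -[X in (X <= _)%N]/(size (q :: [seq x <- primes d | (x < q0)%N])).
apply: uniq_leq_size => [|p].
  rewrite /= filter_uniq ?primes_uniq // andbT mem_filter negb_and mem_primes.
  by apply/orP; right; move: cqd; rewrite prime_coprime // => /negPf ->; rewrite !andbF.
rewrite inE !mem_filter !mem_primes => /orP[/eqP ->|/and4P[-> -> _ pd]] /=.
  by rewrite qq0 pq m0 (dvdn_trans _ dm) // dvdn_mulr.
by rewrite m0 (dvdn_trans pd) // (dvdn_trans _ dm) // dvdn_mull.
Qed.

Lemma powR_nat_ge1 (u : nat) (x : R) : 0 <= x -> (0 < u)%N -> 1 <= u%:R `^ x.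
Proof.
by move=> x0 u0; apply: le_trans (ler_powR _ x0); rewrite ?powRr0 ?ler1n.
Qed.

Lemma class_bound_ge0 m u : 0 <= class_bound m u.
Proof.
rewrite /class_bound; case: ifP => // _.
by rewrite !mulr_ge0 ?powR_ge0 // exprn_ge0 // (le_trans ler01).
Qed.

Lemma class_bound_mono m m' u : (0 < m)%N -> (m' %| m)%N ->
  class_bound m' u <= class_bound m u.
Proof.
move=> m0 mm; rewrite /class_bound; case: ifP => // _.
rewrite -!mulrA ler_wpM2r ?mulr_ge0 ?powR_ge0 // ler_weXn2l // ltnS.
exact: small_primes_dvd.
Qed.

(** The factor [c0] is paid in one of three ways: by the spare power if v <= 1; by losing the small
    prime [q] if q < q0; and otherwise by v <= 2u / q, which gains (q / 2)^theta >= c0. *)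
Lemma class_bound_step q m m' u v : prime q -> coprime q m' -> (0 < m)%N ->
  (q * m' %| m)%N -> (1 < u <= N)%N -> (v <= u)%N ->
  ((1 < v)%N -> (q * v <= 2 * u)%N) ->
  c0 * class_bound m' v <= class_bound m u.
Proof.
move=> pq cqm m0 mm /andP[u1 uN] vu qv.
have N1 : 1 <= N%:R `^ s%:R^-1 :> R by rewrite powR_nat_ge1 ?invr_ge0 //; lia.
have u_1 : 1 <= u%:R `^ theta :> R by rewrite powR_nat_ge1 //; lia.
have cX n : 0 <= c0 ^+ n by rewrite exprn_ge0 // (le_trans ler01).
rewrite /class_bound (leqNgt u) u1 /=.
case: leqP => v1.
  rewrite mulr1 -mulrA; apply: (@le_trans _ _ (c0 ^+ (small_primes m).+1)).
    by rewrite exprS ler_peMr ?(le_trans ler01) // exprn_ege1.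
  by rewrite ler_peMr // mulr_ege1.
rewrite !mulrA ler_wpM2r ?powR_ge0 // -exprS.
have [qq0|qq0] := ltnP q q0.
  rewrite ler_pM ?powR_ge0 //.
    rewrite ler_weXn2l // ltnS; exact: small_primes_coprime mm.
  by rewrite ge0_ler_powR ?nnegrE // ler_nat.
rewrite exprSr -mulrA; apply: ler_pM => //.
- by rewrite mulr_ge0 ?powR_ge0 // (le_trans ler01).
- rewrite ler_weXn2l // ltnS; apply: small_primes_dvd => //.
  by rewrite (dvdn_trans _ mm) // dvdn_mull.
apply: (le_trans (ler_wpM2r _ q0P)); first exact: powR_ge0.
rewrite -powRM ?mulr_ge0 ?invr_ge0 // ge0_ler_powR ?nnegrE ?mulr_ge0 ?invr_ge0 //.
rewrite mulrAC ler_pdivrMr // -!natrM ler_nat [(u * 2)%N]mulnC.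
by apply: leq_trans (qv v1); rewrite leq_mul2r qq0 orbT.
Qed.

Lemma line_sum_class (U : {set 'I_N}) (F : G -> G -> R) :
  {in U &, forall w w' : 'I_N, line_sum w F =1 line_sum w' F} ->
  \sum_z pnorm s U (fun w => line_sum w F z ^+ 2) <=
  #|U|%:R `^ s%:R^-1 * (#|G|%:R * normsq F).
Proof.
move=> Uc; have [->|[w wU]] := finset.set_0Vmem U.
  rewrite big1 ?mulr_ge0 ?powR_ge0 ?normsq_ge0 // => z _.
  rewrite /pnorm big_set0 powR0 // invr_eq0 pnatr_eq0 -lt0n //.
apply: le_trans (ler_wpM2l (powR_ge0 _ _) (line_sum_sq w F)).
rewrite mulr_sumr; apply: ler_sum => z _.
rewrite (@eq_pnorm _ _ _ U _ (fun=> line_sum w F z ^+ 2)) => [|w' w'U].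
  by rewrite pnorm_const // sqr_ge0.
by rewrite (Uc w' w).
Qed.

(** Strong induction on [m2]. The slopes agree mod [n], hence mod [m1], so only the factor [m2] of
    the period can still separate them. *)
Lemma sum_pnorm_line_sum_le m2 m1 n w0 (F : G -> G -> R) :
  (0 < m1)%N -> (0 < n)%N -> (0 < m2)%N -> (m1 %| n)%N -> coprime m2 n ->
  periodic (m1 * m2) F ->
  \sum_z pnorm s (residue_class N n w0) (fun w => line_sum w F z ^+ 2) <=
  class_bound m2 #|residue_class N n w0| * (#|G|%:R * normsq F).
Proof.
have [M] := ubnP m2; elim: M m2 m1 n w0 F => // M IH m2 m1 n w0 F m2M m10 n0 m20 m1n cmn Fm.
set U := residue_class N n w0.
have gF0 F' : 0 <= #|G|%:R * normsq F' :> R by rewrite mulr_ge0 ?normsq_ge0.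
have UN : (#|U| <= N)%N by rewrite (leq_trans (max_card _)) // card_ord.
have [U1|U1] := leqP #|U| 1.
  apply: (le_trans (line_sum_class _)).
    move=> w w' wU w'U z; congr (line_sum _ F z).
    by move/card_le1_eqP: U1 => /(_ w w' wU w'U) ->.
  rewrite ler_wpM2r // /class_bound U1.
  case: #|U| U1 => [|[|//]] _; last by rewrite powR1.
  by rewrite powR0 // invr_eq0 pnatr_eq0 -lt0n //.
(* For [m2 = 1] all slopes agree modulo the period, and all line sums coincide. *)
have [m21|m21] := leqP m2 1.
  have m2E : m2 = 1%N by lia.
  apply: (le_trans (line_sum_class _)).
    move=> w w' wU w'U z; apply: line_sum_congr Fm _.
    move: wU w'U; rewrite m2E muln1 !inE => /eqP e /eqP e'.
    by rewrite -(modn_dvdm w m1n) -(modn_dvdm w' m1n) e e'.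
  rewrite ler_wpM2r // /class_bound leqNgt U1 /= -[leLHS]mul1r.
  have c1 : 1 <= c0 ^+ (small_primes m2).+1 * #|U|%:R `^ theta.
    by rewrite -[leLHS]mulr1 ler_pM // ?exprn_ege1 // powR_nat_ge1 //; lia.
  by rewrite ler_pM ?powR_ge0 // ge0_ler_powR ?invr_ge0 ?nnegrE // ler_nat.
pose q := pdiv m2; pose k := logn q m2.
have pq : prime q by exact: pdiv_prime.
have qm2 : (q %| m2)%N by exact: pdiv_dvd.
have k0 : (0 < k)%N by rewrite /k logn_gt0 mem_primes pq m20 qm2.
pose m3 := (m2 %/ q ^ k)%N.
have m2E : m2 = (q ^ k * m3)%N by rewrite mulnC divnK // pfactor_dvdnn.
have m30 : (0 < m3)%N by move: m20; rewrite m2E muln_gt0 => /andP[].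
have cq3 : coprime q m3.
  rewrite prime_coprime //; apply/negP => qm3.
  have : (q ^ k.+1 %| m2)%N by rewrite m2E expnSr dvdn_pmul2l // expn_gt0 prime_gt0.
  by rewrite pfactor_dvdn // ltnn.
have cqn : coprime q n by exact: coprime_dvdl qm2 cmn.
pose c := (m1 * m3)%N; pose m' := (q ^ k.-1 * c)%N.
have c_gt0 : (0 < c)%N by rewrite muln_gt0 m10.
have mE : (m1 * m2 = q ^ k * c)%N by rewrite m2E /c; lia.
(* [E] has period m1 m2 / q and is treated with the same slopes and no loss; [H] is the rest, for
   which the slopes separate mod q^k. *)
pose E := group_avg 0 m' F; pose H n z := F n z - E n z.
have Ep : periodic m' E by exact: periodic_group_avg0.
have Hp : periodic (q ^ k * c) H.
  by move=> x z t; rewrite /H -mE Fm /E (periodic_group_avg _ _ Fm).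
have EH x z : group_avg 0 m' H x z = 0.
  by rewrite group_avgB group_avg_idem subrr.
have qk0 : (0 < q ^ k)%N by rewrite expn_gt0 prime_gt0.
have bE : \sum_z pnorm s U (fun w => line_sum w E z ^+ 2) <=
    class_bound m2 #|U| * (#|G|%:R * normsq E).
  pose m2' := (q ^ k.-1 * m3)%N.
  have m2'E : m2 = (q * m2')%N by rewrite m2E /m2' mulnA -expnS prednK.
  have m2'0 : (0 < m2')%N by move: m20; rewrite m2'E muln_gt0 => /andP[].
  apply: (@le_trans _ _ (class_bound m2' #|U| * (#|G|%:R * normsq E))); last first.
    by rewrite ler_wpM2r // class_bound_mono // m2'E dvdn_mull.
  apply: (IH _ m1) => //.
  - by rewrite -ltnS (leq_trans _ m2M) // ltnS m2'E ltn_Pmull // prime_gt1.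
  - by apply: coprime_dvdl cmn; rewrite m2'E dvdn_mull.
  - by rewrite /m2' mulnCA.
have bH : c0 * \sum_z pnorm s U (fun w => line_sum w H z ^+ 2) <=
    class_bound m2 #|U| * (#|G|%:R * normsq H).
  (* On the slopes congruent to [a] mod q^k, [H] may be replaced by its average [Ha] in direction
     [a]. These slopes form a class mod n q^k, so q^k passes from [m2] to [m1]; Bessel then sums the
     norms over [a]. *)
  pose V (a : 'I_(q ^ k)) := U :&: residue_class N (q ^ k) a.
  pose Ha (a : nat) := group_avg c (a * c) H.
  apply: (@le_trans _ _ (\sum_a c0 * \sum_z pnorm s (V a) (fun w => line_sum w H z ^+ 2))).
    rewrite -mulr_sumr ler_wpM2l ?(le_trans ler01) // exchange_big /=.
    apply: ler_sum => z _; apply: pnorm_cover => // [w|w wU]; first exact: sqr_ge0.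
    exists (Ordinal (ltn_pmod w qk0)).
    by rewrite !inE modn_mod eqxx andbT; rewrite inE in wU.
  apply: (@le_trans _ _ (\sum_(a < q ^ k) class_bound m2 #|U| * (#|G|%:R * normsq (Ha a)))).
    apply: ler_sum => a _.
    have [->|[w1]] := finset.set_0Vmem (V a).
      rewrite big1 ?mulr0 ?mulr_ge0 ?class_bound_ge0 ?normsq_ge0 // => z _.
      rewrite /pnorm big_set0 powR0 // invr_eq0 pnatr_eq0 -lt0n //.
    rewrite finset.in_setI => /andP[w1U]; rewrite inE => /eqP w1a.
    have VE : V a = residue_class N (n * q ^ k) w1.
      apply: residue_classI => //; exact: coprimeXr (etrans (coprime_sym _ _) cqn).
    have VU : V a \subset U by exact: finset.subsetIl.
    have -> : \sum_z pnorm s (V a) (fun w => line_sum w H z ^+ 2) =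
        \sum_z pnorm s (V a) (fun w => line_sum w (Ha a) z ^+ 2).
      apply: eq_bigr => z _; apply: eq_pnorm => w; rewrite !inE => /andP[_ /eqP wa].
      rewrite (@line_sum_group_avg _ _ (q ^ k * c)) //.
      by rewrite -!muln_modl wa.
    have bV : \sum_z pnorm s (V a) (fun w => line_sum w (Ha a) z ^+ 2) <=
        class_bound m3 #|V a| * (#|G|%:R * normsq (Ha a)).
      rewrite VE; apply: (IH m3 (m1 * q ^ k)%N) => //.
      - rewrite -ltnS (leq_trans _ m2M) // ltnS m2E.
        by rewrite ltn_Pmull // -(exp1n k) ltn_exp2r // prime_gt1.
      - by rewrite muln_gt0 m10.
      - by rewrite muln_gt0 n0.
      - by rewrite dvdn_mul.
      - rewrite coprimeMr coprimeXr 1?coprime_sym // andbT.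
        by rewrite coprime_sym; apply: coprime_dvdl cmn; rewrite m2E dvdn_mull.
      - rewrite -mulnA [(q ^ k * m3)%N]mulnC mulnA mulnC; exact: periodic_group_avg.
    apply: (le_trans (ler_wpM2l (le_trans ler01 c01) bV)).
    rewrite [leLHS]mulrA ler_wpM2r //; apply: (class_bound_step pq) => //.
    - by rewrite m2E dvdn_pmul2r // -{1}(expn1 q) dvdn_exp2l.
    - by rewrite U1.
    - exact: subset_leq_card.
    - move=> V1; have qk : (n * q %| n * q ^ k)%N.
        by rewrite dvdn_pmul2l // -{1}(expn1 q) dvdn_exp2l.
      have sub := subset_leq_card (residue_class_sub N w1 qk).
      rewrite VE in V1 *; apply: (leq_trans (leq_mul (leqnn q) sub)).
      apply: (leq_trans (card_residue_class_split n0 (prime_gt0 pq) (leq_trans V1 sub))).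
      rewrite leq_mul2l /=; apply: subset_leq_card; apply/fintype.subsetP => w.
      by move: w1U; rewrite !inE => /eqP -> .
  rewrite -mulr_sumr -mulr_sumr !ler_wpM2l ?class_bound_ge0 //.
  exact: (normsq_group_avg_sum pq k0 c_gt0 erefl erefl Hp EH).
have FE w z : line_sum w F z = line_sum w E z + line_sum w H z.
  by rewrite /line_sum -big_split; apply: eq_bigr => x _; rewrite /H [RHS]addrC subrK.
have -> : \sum_z pnorm s U (fun w => line_sum w F z ^+ 2) =
    \sum_z pnorm s U (fun w => (line_sum w E z + line_sum w H z) ^+ 2).
  by apply: eq_bigr => z _; apply: eq_pnorm => w _; rewrite FE.
apply: (le_trans (@smooth_step _ _ _ _ s0 m' _ _ _ _ _)).
- by move=> w z t; apply: eq_bigr => x _; rewrite addrAC Ep.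
- by move=> w z; rewrite sum_line_sum /line_sum big1 ?mulr0.
rewrite (normsq_split 0 m' F) -/E mulrDr mulrDr lerD //.
Qed.

End FiniteMaximal.

(** Half of [theta] pays for N^(1/s), with [s] at least 2 / theta, the other half for the power of
    [u] in [class_bound]. *)
Lemma line_sum_maximal (R : realType) (theta : R) : 0 < theta ->
  exists K : R, 0 < K /\ forall (G : finZmodType) (M N : nat),
    (0 < M)%N -> (forall x : G, x *+ M = 0) ->
  forall (j : G -> 'I_N) (F : G -> G -> R),
  \sum_z line_sum (j z) F z ^+ 2 <= K * N%:R `^ theta * (#|G|%:R * normsq F).
Proof.
move=> th0; pose th := theta / 2; have th'0 : 0 < th by rewrite /th; lra.
pose s := (Num.truncn th^-1).+1.
have s_th : s%:R^-1 <= th.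
  by rewrite invf_ple ?posrE ?ltr0n // ltW // truncnS_gt.
pose c0 : R := 2 * smooth_const R s.
have c01 : 1 <= c0 by have := smooth_const_ge1 R s; rewrite /c0; lra.
pose q0 := (Num.truncn (2 * c0 `^ th^-1)).+1.
have q0P : 2 * smooth_const R s <= (q0%:R / 2) `^ th.
  have c0E : (c0 `^ th^-1) `^ th = c0.
    by rewrite -powRrM mulVf ?gt_eqF // powRr1 // (le_trans ler01).
  rewrite -/c0 -[leLHS]c0E; apply: ge0_ler_powR; rewrite ?nnegrE ?powR_ge0 ?divr_ge0 ?ltW //.
  by rewrite ltr_pdivlMr // mulrC truncnS_gt.
(* At most [q0] primes lie below [q0], whatever the period is. *)
exists (c0 ^+ q0.+1); split; first by rewrite exprn_gt0 // (lt_le_trans ltr01).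
move=> G M N M0 GM j F.
have N0 : (0 < N)%N by case: N j => // j; case: (j 0).
have N1 : 1 <= N%:R :> R by rewrite ler1n.
have gF0 : 0 <= #|G|%:R * normsq F :> R by rewrite mulr_ge0 ?normsq_ge0.
have Fp : periodic (1 * M) F by move=> n z t; rewrite mul1n GM addr0.
(* The recursion starts from the class mod 1, which contains all slopes. *)
have main := @sum_pnorm_line_sum_le R G N s q0 th isT (ltW th'0) q0P M 1 1 0 F
  isT isT M0 isT (coprimen1 _) Fp.
apply: (@le_trans _ _ (\sum_z pnorm s (residue_class N 1 0) (fun w => line_sum w F z ^+ 2))).
  apply: ler_sum => z _.
  apply: (@le_pnorm _ _ _ _ _ (fun w : 'I_N => line_sum w F z ^+ 2)) => // [w|].
    exact: sqr_ge0.
  by rewrite inE !modn1.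
apply: (le_trans main); rewrite ler_wpM2r //.
have UN : (#|residue_class N 1 0| <= N)%N by rewrite (leq_trans (max_card _)) // card_ord.
have Nth : N%:R `^ theta = N%:R `^ th * N%:R `^ th :> R.
  have {1}-> : theta = th + th by rewrite /th; field.
  by rewrite powRD // (gt_eqF (lt_le_trans ltr01 N1)) implybT.
have cX : 1 <= c0 ^+ q0.+1 by rewrite exprn_ege1.
have Nt1 : 1 <= N%:R `^ th :> R by rewrite powR_nat_ge1 // ltW.
rewrite /class_bound; case: ifP => _.
  by rewrite Nth mulr_ege1 // mulr_ege1.
have cX0 n : 0 <= c0 ^+ n by rewrite exprn_ge0 // (le_trans ler01).
rewrite Nth mulrA; apply: ler_pM; [by rewrite mulr_ge0 ?powR_ge0|exact: powR_ge0| |].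
  apply: ler_pM; [exact: cX0|exact: powR_ge0| |].
    rewrite ler_weXn2l // ltnS /small_primes -size_filter -[leqRHS](size_iota 0).
    apply: uniq_leq_size; first by rewrite filter_uniq ?primes_uniq.
    by move=> q; rewrite mem_filter mem_iota => /andP[].
  by rewrite ge0_ler_powR ?nnegrE ?ler_nat // ltW.
by rewrite ler_powR.
Qed.

(** * Duality between line sums and incidences *)

Section Incidence.
Variables (R : realType) (G : finZmodType) (X : finType) (N : nat).
Variables (P : pred X) (rho : X -> G) (j : X -> 'I_N) (g : X -> R).

Definition incidences x y := #|[set n : G | rho x + n *+ j x == rho y + n *+ j y]|.

(** TT*: the left side is the squared norm Q of the adjoint applied to [g], and also the pairing of
    [g] with line sums of that function. Cauchy-Schwarz and the maximal bound give Q^2 <= t K Q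
    times the squared norm of [g]. *)
Lemma sum_incidences_le (K : R) (t : nat) : (0 < N)%N -> 0 <= K ->
  (forall c, #|[set x | P x & rho x == c]| <= t)%N ->
  (forall (w : G -> 'I_N) (F : G -> G -> R),
     \sum_z line_sum (w z) F z ^+ 2 <= K * normsq F) ->
  \sum_(x | P x) \sum_(y | P y) g x * g y * (incidences x y)%:R <=
  t%:R * K * \sum_(x | P x) g x ^+ 2.
Proof.
move=> N0 K0 fib HK.
pose u (n c : G) := \sum_(x | P x && (rho x + n *+ j x == c)) g x.
have uE n c : u n c = \sum_(x | P x) g x * (rho x + n *+ j x == c)%:R.
  rewrite /u big_mkcondr /=; apply: eq_bigr => x _.
  by case: eqP; rewrite ?mulr1 ?mulr0.
set S := \sum_(x | P x) g x ^+ 2; pose Q := normsq u.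
have -> : \sum_(x | P x) \sum_(y | P y) g x * g y * (incidences x y)%:R = Q.
  rewrite /Q /normsq (eq_bigr (fun n => \sum_(x | P x) \sum_(y | P y)
      g x * g y * (rho x + n *+ j x == rho y + n *+ j y)%:R)); last first.
    move=> n _; under eq_bigr => c _ do rewrite expr2 !uE mulr_suml.
    rewrite exchange_big /=; apply: eq_bigr => x _.
    under eq_bigr => c _ do rewrite mulr_sumr.
    rewrite exchange_big /=; apply: eq_bigr => y _.
    rewrite (bigD1 (rho x + n *+ j x)) //= eqxx mulr1 big1 ?addr0 => [|c].
      by rewrite mulrA [_ == rho x + _]eq_sym.
    by rewrite eq_sym => /negPf ->; rewrite mulr0 mul0r.
  rewrite [RHS]exchange_big /=; apply: eq_bigr => x _.
  rewrite [RHS]exchange_big /=; apply: eq_bigr => y _.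
  rewrite -mulr_sumr; congr (_ * _); rewrite /incidences -sum1dep_card natr_sum big_mkcond /=.
  by apply: eq_bigr => n _; case: eqP.
have QE : Q = \sum_(x | P x) g x * line_sum (j x) u (rho x).
  rewrite /Q /normsq.
  under eq_bigr => n _ do under eq_bigr => c _ do rewrite expr2 {1}uE mulr_suml.
  under eq_bigr => n _ do rewrite exchange_big /=.
  rewrite exchange_big /=; apply: eq_bigr => x _.
  rewrite /line_sum mulr_sumr; apply: eq_bigr => n _.
  rewrite (bigD1 (rho x + n *+ j x)) //= eqxx mulr1 big1 ?addr0 // => c.
  by rewrite eq_sym => /negPf ->; rewrite mulr0 mul0r.
have Q0 : 0 <= Q by exact: normsq_ge0.
have S0 : 0 <= S by apply: sumr_ge0 => x _; exact: sqr_ge0.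
have [->|Qn0] := eqVneq Q 0; first by rewrite !mulr_ge0.
have Qgt0 : 0 < Q by rewrite lt_def Qn0.
rewrite -(ler_pM2r Qgt0) -expr2 {1}QE.
apply: (le_trans (cauchy_schwarz _ _ _ _)).
have -> : t%:R * K * S * Q = S * (t%:R * (K * Q)) by ring.
rewrite ler_wpM2l //.
pose w0 := Ordinal N0.
(* Points with the same residue may carry different slopes; each is replaced by the best slope of
   that residue, at the cost of the fibre size [t]. *)
pose w z := [arg max_(i > w0) (line_sum i u z ^+ 2)]%O.
have wP z (i : 'I_N) : line_sum i u z ^+ 2 <= line_sum (w z) u z ^+ 2.
  by rewrite /w; case: Order.TotalTheory.arg_maxP => // i' _; apply.
rewrite (partition_big rho xpredT) //=.
apply: le_trans (ler_wpM2l (ler0n _ t) (HK w u)); rewrite mulr_sumr.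
apply: ler_sum => z _.
apply: (@le_trans _ _ (\sum_(x | P x && (rho x == z)) line_sum (w z) u z ^+ 2)).
  by apply: ler_sum => x /andP[_ /eqP ->].
rewrite sumr_const -[leLHS]mulr_natl ler_wpM2r ?sqr_ge0 // ler_nat.
by apply: leq_trans (fib z); rewrite cardsE.
Qed.

End Incidence.

(** * Slices of the lattice *)

Lemma inZp_line (M x n w : nat) :
  inZp x + inZp n *+ w = inZp (x + n * w) :> 'I_M.+1.
Proof. rewrite Zp_mulrn; apply: val_inj => /=. by rewrite modnMml modnDm. Qed.

Section Slice.
Variables (R : realType) (N L M T : nat) (j : 'I_T -> 'I_N).
Implicit Types (x y : 'I_T).

(** The distance of the slopes: with truncated subtraction one of the two terms vanishes. *)
Definition slope_gap x y := ((j x - j y) + (j y - j x))%N.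

(** The column offset is i - L, running over [-L, L]; terms are moved across the equation to stay in
    [nat]. *)
Definition meetings x y :=
  #|[set i : 'I_(L.*2.+1) | (x + i * j x + L * j y == y + i * j y + L * j x)%N]|.

Lemma meetings_eq_slope x y : j x = j y -> x != y -> meetings x y = 0%N.
Proof.
move=> jxy xy; apply: eq_card0 => i; rewrite inE -jxy -!addnA eqn_add2r.
exact: negbTE.
Qed.

Lemma meetings_le1 x y : j x != j y -> (meetings x y <= 1)%N.
Proof.
rewrite -val_eqE /= => jxy; apply/card_le1_eqP => i i'.
rewrite !inE => /eqP e /eqP e'; apply: val_inj => /=.
have e2 : (i * j x + i' * j y = i' * j x + i * j y)%N by lia.
have {e e'}: (i%:Z - i'%:Z) * ((j x)%:Z - (j y)%:Z) = 0 by lia.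
move/eqP; rewrite mulf_eq0 !subr_eq0 !eqz_nat (negPf jxy) orbF => /eqP.
by [].
Qed.

(** A common point gives x - y = n (j y - j x) with |n| <= L. *)
Lemma meetings_gt0 x y : (0 < meetings x y)%N ->
  (x = y %[mod slope_gap x y]) /\
  ((x <= y + L * slope_gap x y) /\ (y <= x + L * slope_gap x y))%N.
Proof.
case/card_gt0P => i; rewrite inE /slope_gap => /eqP e.
have iL : (i <= L.*2)%N by rewrite -ltnS.
have key (a b p q : nat) : (p <= q -> a + i * p + L * q = b + i * q + L * p ->
    [/\ a + L * (q - p) = b + i * (q - p), a <= b + L * (q - p) &
       b <= a + L * (q - p)])%N.
  move=> /subnKC <-; move: (q - p)%N => d; rewrite !mulnDr => h.
  have {}h : (a + L * d = b + i * d)%N by lia.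
  rewrite addKn h; split => //; last by lia.
  have : (i * d <= L * d + L * d)%N by rewrite -mulnDl addnn leq_mul2r iL orbT.
  lia.
have cong a b d : (a + L * d = b + i * d)%N -> (a = b %[mod d]).
  by move=> h; rewrite -(modnMDl L a) -(modnMDl i b) addnC h addnC.
have [xy|/ltnW xy] := leqP (j x) (j y).
  have -> : (j x - j y = 0)%N by apply/eqP; rewrite subn_eq0.
  by have [/cong h h1 h2] := key _ _ _ _ xy e.
have -> : (j y - j x = 0)%N by apply/eqP; rewrite subn_eq0.
by rewrite addn0; have [/cong h h1 h2] := key _ _ _ _ xy (esym e).
Qed.

Lemma slope_gap_gt0 x y : j x != j y -> (0 < slope_gap x y)%N.
Proof. by rewrite -val_eqE /slope_gap /=; lia. Qed.

Lemma slope_gap_lt x y : (slope_gap x y < N)%N.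
Proof. by rewrite /slope_gap; have := ltn_ord (j x); have := ltn_ord (j y); lia. Qed.

Let rho x : 'I_M.+1 := inZp x.

Lemma incidencesC x y : incidences rho j x y = incidences rho j y x.
Proof. by apply: eq_card => n; rewrite !inE eq_sym. Qed.

Lemma slope_gapC x y : slope_gap x y = slope_gap y x.
Proof. exact: addnC. Qed.

(** With d the gap, the congruence n d = y - x mod M + 1 has d solutions, spaced by (M + 1) / d, as
    soon as d divides both M + 1 and y - x. *)
Lemma incidences_ge x y : (0 < slope_gap x y)%N -> (slope_gap x y %| M.+1)%N ->
  x = y %[mod slope_gap x y] -> (slope_gap x y <= incidences rho j x y)%N.
Proof.
wlog xy : x y / (j y <= j x)%N.
  move=> wl; have [xy|/ltnW xy] := leqP (j y) (j x); first exact: wl.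
  by rewrite slope_gapC incidencesC => d0 dM e; apply: wl.
rewrite /slope_gap; have -> : (j y - j x = 0)%N by apply/eqP; rewrite subn_eq0.
rewrite addn0; set d := (j x - j y)%N => d0 dM xyd.
(* Adding (M + 1) x keeps the residue and makes the difference nonnegative in [nat]. *)
have [e ee] : exists e, (x + e * d = y + M.+1 * x)%N.
  have xM : (x <= y + M.+1 * x)%N by rewrite (leq_trans _ (leq_addl _ _)) // leq_pmull.
  have : (d %| y + M.+1 * x - x)%N.
    rewrite -eqn_mod_dvd // xyd; apply/eqP.
    by case/dvdnP: dM => c ->; rewrite addnC mulnAC modnMDl.
  by case/dvdnP => e ee; exists e; rewrite -ee subnKC.
have [r rE] : exists r, (r * d = M.+1)%N by case/dvdnP: dM => r; exists r.
have r0 : (0 < r)%N by rewrite lt0n; apply: contra_eq_neq rE => ->.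
pose f (i : 'I_d) : 'I_M.+1 := inZp (e + i * r).
have finj : injective f.
  move=> i i' /(congr1 val) /= /eqP; rewrite eqn_modDl.
  have lt (k : 'I_d) : (k * r < M.+1)%N by rewrite -rE mulnC ltn_pmul2l.
  rewrite (modn_small (lt i)) (modn_small (lt i')) eqn_pmul2r // => /eqP.
  exact: val_inj.
rewrite -[X in (X <= _)%N]card_ord -(card_imset _ finj).
apply: subset_leq_card; apply/fintype.subsetP => n /imsetP[i _ ->].
rewrite inE /rho !inZp_line; apply/eqP; apply: val_inj => /=.
have -> : (x + (e + i * r) * j x = x + e * d + i * (r * d) + (e + i * r) * j y)%N.
  by rewrite -{1}(subnK xy) -/d; lia.
rewrite rE ee.
have -> : (y + M.+1 * x + i * M.+1 + (e + i * r) * j y =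
  (x + i) * M.+1 + (y + (e + i * r) * j y))%N by lia.
by rewrite modnMDl.
Qed.

End Slice.

Lemma leq_card_seq (T : finType) (A : {set T}) (f : T -> nat) (s : seq nat) :
  {in A &, injective f} -> {in A, forall x, f x \in s} -> (#|A| <= size s)%N.
Proof.
move=> finj fs; rewrite cardE -(size_map f); apply: uniq_leq_size.
  by rewrite map_inj_in_uniq ?enum_uniq // => x y; rewrite !mem_enum; exact: finj.
by move=> v /mapP[x]; rewrite mem_enum => xA ->; exact: fs.
Qed.

Section SliceBound.
Variables (R : realType) (N L M T : nat) (j : 'I_T -> 'I_N) (g : 'I_T -> R) (kappa : R).
Hypothesis g0 : forall x, 0 <= g x.
Hypothesis kappa0 : 0 <= kappa.
Hypothesis N0 : (0 < N)%N.
Hypothesis divM : forall d, (0 < d < N)%N -> (d %| M.+1)%N.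
Hypothesis ML : (M.+1 <= L)%N.
Hypothesis HK : forall (w : 'I_M.+1 -> 'I_N) (F : 'I_M.+1 -> 'I_M.+1 -> R),
  \sum_z line_sum (w z) F z ^+ 2 <= kappa * M.+1%:R * normsq F.
Implicit Types (x y : 'I_T).

Let rho x : 'I_M.+1 := inZp x.
(** Two consecutive blocks of length (M + 1) r: points at distance at most one block length share a
    window, and each residue mod M + 1 occurs at most 2r times in it. *)
Let window (r b : nat) : pred 'I_T := fun x => (b <= x %/ M.+1 %/ r <= b.+1)%N.

Lemma window_sum (r b : nat) : (0 < r)%N ->
  \sum_(x | window r b x) \sum_(y | window r b y) g x * g y * (incidences rho j x y)%:R <=
  (2 * r)%:R * (kappa * M.+1%:R) * \sum_(x | window r b x) g x ^+ 2.
Proof.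
move=> r0; apply: sum_incidences_le => //; first by rewrite mulr_ge0.
move=> c; rewrite -(size_iota (b * r) (2 * r)).
apply: (@leq_card_seq _ _ (fun x => x %/ M.+1)%N) => [x y|x]; rewrite !inE.
  move=> /andP[_ /eqP xc] /andP[_ /eqP yc] xy; apply: val_inj => /=.
  have /(congr1 val) /= e : rho x = rho y by rewrite xc yc.
  by rewrite (divn_eq x M.+1) (divn_eq y M.+1) xy e.
case/andP => /andP[bx xb] _; rewrite mem_iota.
have -> : (b * r + 2 * r = b.+2 * r)%N by rewrite -mulnDl addn2.
by rewrite -leq_divRL // bx -ltn_divLR // ltnS.
Qed.

(** A pair counted here has at least 2^i incidences, so its indicator is at most 2^-i times their
    number. This larger kernel is bounded window by window. *)
Lemma dyadic_sum i :
  \sum_x \sum_y g x * g y * [&& (2 ^ i <= slope_gap j x y)%N, x == y %[mod slope_gap j x y],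
     (x <= y + L * 2 ^ i.+1)%N & (y <= x + L * 2 ^ i.+1)%N]%:R <=
  16 * kappa * L%:R * \sum_x g x ^+ 2.
Proof.
(* The block length (M + 1) r lies between L 2^(i+1) and twice that, the upper bound using M + 1 <=
   L. *)
pose r := ((L * 2 ^ i.+1) %/ M.+1).+1; pose beta x := (x %/ M.+1 %/ r)%N.
have r0 : (0 < r)%N by [].
have len1 : (L * 2 ^ i.+1 <= M.+1 * r)%N by rewrite ltnW // [(M.+1 * _)%N]mulnC /r ltn_ceil.
have len2 : (M.+1 * r <= 2 * (L * 2 ^ i.+1))%N.
  rewrite /r mulnS mul2n -addnn leq_add ?[(M.+1 * _)%N]mulnC ?leq_divM //.
  by rewrite (leq_trans ML) // leq_pmulr // expn_gt0.
have near x y : (y <= x + L * 2 ^ i.+1)%N -> (beta y <= (beta x).+1)%N.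
  move=> yx; rewrite /beta -!divnMA.
  have -> : ((x %/ (M.+1 * r)).+1 = (x + M.+1 * r) %/ (M.+1 * r))%N.
    by rewrite divnDr // divnn muln_gt0 /= addn1.
  by rewrite leq_div2r // (leq_trans yx) // leq_add2l.
have twoi : 0 < 2 ^+ i :> R by rewrite exprn_gt0.
apply: (@le_trans _ _ (\sum_x \sum_y \sum_(b < T | window r b x && window r b y)
    (2 ^+ i)^-1 * (g x * g y * (incidences rho j x y)%:R))).
  apply: ler_sum => x _; apply: ler_sum => y _.
  have gg : 0 <= g x * g y by rewrite mulr_ge0.
  case: and4P => [[gap /eqP xy xLy yLx]|_]; last first.
    rewrite mulr0; apply: sumr_ge0 => b _.
    by rewrite mulr_ge0 ?invr_ge0 ?(ltW twoi) // mulr_ge0.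
  have gap0 : (0 < slope_gap j x y)%N by rewrite (leq_trans _ gap) // expn_gt0.
  have inc := incidences_ge (M := M) gap0 (divM (introT andP (conj gap0 (slope_gap_lt _ _ _)))) xy.
  have bT : (minn (beta x) (beta y) < T)%N.
    apply: leq_ltn_trans (ltn_ord x); apply: leq_trans (geq_minl _ _) _.
    by rewrite /beta (leq_trans (leq_div _ _)) // leq_div.
  have h1 := near _ _ xLy; have h2 := near _ _ yLx.
  have hx : window r (Ordinal bT) x by rewrite /window -/(beta x) /=; lia.
  have hy : window r (Ordinal bT) y by rewrite /window -/(beta y) /=; lia.
  rewrite (bigD1 (Ordinal bT)) ?hx ?hy //= mulr1 -[leLHS]addr0; apply: lerD.
    rewrite [leRHS]mulrCA ler_peMr // ler_pdivlMl // mulr1 -natrX ler_nat.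
    exact: leq_trans gap inc.
  by apply: sumr_ge0 => b _; rewrite mulr_ge0 ?invr_ge0 ?(ltW twoi) // mulr_ge0.
have swap (h : 'I_T -> 'I_T -> R) :
    \sum_x \sum_y \sum_(b < T | window r b x && window r b y) h x y =
    \sum_(b < T) \sum_(x | window r b x) \sum_(y | window r b y) h x y.
  transitivity (\sum_x \sum_(b < T) \sum_y if window r b x && window r b y then h x y else 0).
    apply: eq_bigr => x _; rewrite [RHS]exchange_big /=; apply: eq_bigr => y _.
    exact: big_mkcond.
  rewrite exchange_big; apply: eq_bigr => b _; rewrite [RHS]big_mkcond.
  apply: eq_bigr => x _; case: (window r b x) => /=; first by rewrite [RHS]big_mkcond.
  by rewrite big1.
rewrite swap; apply: (@le_trans _ _ (\sum_(b < T) (2 ^+ i)^-1 *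
   ((2 * r)%:R * (kappa * M.+1%:R) * \sum_(x | window r b x) g x ^+ 2))).
  apply: ler_sum => b _; under eq_bigr do rewrite -mulr_sumr.
  by rewrite -mulr_sumr ler_wpM2l ?invr_ge0 ?(ltW twoi) // window_sum.
rewrite -mulr_sumr -mulr_sumr.
(* Each [x] lies in at most two windows, those starting at its own block and at the preceding
   one. *)
have overlap : \sum_(b < T) \sum_(x | window r b x) g x ^+ 2 <= 2 * \sum_x g x ^+ 2.
  rewrite (exchange_big_dep xpredT) //= mulr_sumr; apply: ler_sum => x _.
  rewrite sumr_const -[leLHS]mulr_natl ler_wpM2r ?sqr_ge0 // ler_nat.
  rewrite (_ : #|_| = #|[set b : 'I_T | window r b x]|); last by rewrite cardsE.
  apply: (@leq_card_seq _ _ val [:: beta x; (beta x).-1]) => [b b' _ _|b].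
    exact: val_inj.
  by rewrite inE /window -/(beta x) !inE /=; lia.
apply: (@le_trans _ _ ((2 ^+ i)^-1 * ((2 * r)%:R * (kappa * M.+1%:R) * (2 * \sum_x g x ^+ 2)))).
  by rewrite !ler_wpM2l // ?invr_ge0 ?(ltW twoi) // !mulr_ge0.
have S0 : 0 <= \sum_x g x ^+ 2 by apply: sumr_ge0 => x _; exact: sqr_ge0.
rewrite ler_pdivrMl //.
have -> : (2 * r)%:R * (kappa * M.+1%:R) * (2 * \sum_x g x ^+ 2) =
   4 * kappa * (M.+1 * r)%:R * \sum_x g x ^+ 2 by rewrite !natrM; ring.
have -> : 2 ^+ i * (16 * kappa * L%:R * \sum_x g x ^+ 2) =
   4 * kappa * (2 * (L * 2 ^ i.+1))%:R * \sum_x g x ^+ 2.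
  by rewrite !natrM natrX exprS; ring.
by rewrite !ler_wpM2r // !ler_wpM2l ?ler_nat // mulr_ge0.
Qed.

(** The diagonal contributes 2L + 1 <= 3L, equal slopes at distinct points nothing, and any other
    meeting pair is counted at the dyadic scale of its gap, one of trunc_log N + 1 scales. *)
Lemma slice_form :
  \sum_x \sum_y g x * g y * (meetings L j x y)%:R <=
  L%:R * (3 + 16 * kappa * (trunc_log 2 N).+1%:R) * \sum_x g x ^+ 2.
Proof.
pose A i x y := [&& (2 ^ i <= slope_gap j x y)%N, x == y %[mod slope_gap j x y],
     (x <= y + L * 2 ^ i.+1)%N & (y <= x + L * 2 ^ i.+1)%N].
pose I := (trunc_log 2 N).+1.
have L0 : (0 < L)%N by exact: leq_trans ML.
apply: (@le_trans _ _ (\sum_x \sum_y g x * g y *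
   ((x == y)%:R * L.*2.+1%:R + \sum_(i < I) (A i x y)%:R))).
  apply: ler_sum => x _; apply: ler_sum => y _; rewrite ler_wpM2l ?mulr_ge0 //.
  have A0 : 0 <= \sum_(i < I) (A i x y)%:R :> R by exact: sumr_ge0.
  have [jxy|jxy] := eqVneq (j x) (j y).
    have [xy|xy] := eqVneq x y; last by rewrite meetings_eq_slope // mul0r add0r.
    rewrite mul1r -[leLHS]addr0 lerD // ler_nat /meetings.
    by rewrite (leq_trans (max_card _)) // card_ord.
  have [/eqP ->|] := boolP (meetings L j x y == 0%N).
    by rewrite addr_ge0 // mulr_ge0.
  rewrite -lt0n => m0; have [xy [xLy yLx]] := meetings_gt0 m0.
  have gap0 := slope_gap_gt0 jxy.
  have iI : (trunc_log 2 (slope_gap j x y) < I)%N.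
    by rewrite ltnS leq_trunc_log // ltnW // slope_gap_lt.
  have /andP[lo hi] := trunc_log_bounds (isT : 1 < 2)%N gap0.
  rewrite -[leLHS]add0r lerD ?mulr_ge0 // (bigD1 (Ordinal iI)) //=.
  rewrite -[leLHS]addr0 lerD ?sumr_ge0 // (_ : A _ _ _ = true).
    by rewrite ler_nat meetings_le1.
  rewrite /A lo; apply/and4P; split => //; first exact/eqP.
    by rewrite (leq_trans xLy) // leq_add2l leq_mul2l ltnW ?orbT.
  by rewrite (leq_trans yLx) // leq_add2l leq_mul2l ltnW ?orbT.
have S0 : 0 <= \sum_x g x ^+ 2 by apply: sumr_ge0 => x _; exact: sqr_ge0.
have -> : \sum_x \sum_y g x * g y * ((x == y)%:R * L.*2.+1%:R + \sum_(i < I) (A i x y)%:R) =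
   L.*2.+1%:R * (\sum_x g x ^+ 2) + \sum_(i < I) \sum_x \sum_y g x * g y * (A i x y)%:R.
  rewrite [X in _ = _ + X]exchange_big mulr_sumr -big_split /=; apply: eq_bigr => x _.
  rewrite [X in _ = _ + X]exchange_big /=.
  under eq_bigr do rewrite mulrDr.
  rewrite big_split /=; congr (_ + _); last by apply: eq_bigr => y _; rewrite mulr_sumr.
  rewrite (bigD1 x) //= eqxx mul1r big1 ?addr0 => [|y]; first by rewrite mulrC expr2.
  by rewrite eq_sym => /negPf ->; rewrite mul0r mulr0.
apply: (@le_trans _ _ (L.*2.+1%:R * (\sum_x g x ^+ 2) +
    \sum_(i < I) 16 * kappa * L%:R * \sum_x g x ^+ 2)).
  by rewrite lerD2l; apply: ler_sum => i _; exact: dyadic_sum.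
rewrite sumr_const card_ord -[X in _ + X]mulr_natl -/I.
have L3 : L.*2.+1%:R <= 3 * L%:R :> R by rewrite -natrM ler_nat; lia.
have -> : L%:R * (3 + 16 * kappa * I%:R) * (\sum_x g x ^+ 2) =
  3 * L%:R * (\sum_x g x ^+ 2) + I%:R * (16 * kappa * L%:R * \sum_x g x ^+ 2) by ring.
by rewrite lerD2r ler_wpM2r.
Qed.

End SliceBound.

(** * From slices to the lattice *)

Lemma sum_uniq_subset (R : nmodType) (E : eqType) (X Y : seq E) (F : E -> R) :
  uniq X -> uniq Y -> {subset X <= Y} ->
  \sum_(x <- X) F x = \sum_(y <- Y | y \in X) F y.
Proof.
move=> uX uY XY; rewrite -[RHS]big_filter; apply: perm_big; apply: uniq_perm => //.
  exact: filter_uniq.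
move=> x; rewrite mem_filter; case xX: (x \in X) => //=.
by rewrite XY.
Qed.

(** The form bound is tested on h, the sums over [i] themselves: their squared norm S is the pairing
    of [f] with the adjoint [u] of h, whose squared norm is at most C S. Cauchy-Schwarz
    concludes. *)
Lemma ttstar (R : realFieldType) (X I : finType) (E : eqType) (p : X -> I -> E)
    (f : E -> R) (C : R) : (forall e, 0 <= f e) -> 0 <= C ->
  (forall h : X -> R, (forall x, 0 <= h x) ->
    \sum_x \sum_y h x * h y * (\sum_i \sum_k (p x i == p y k)%:R) <= C * \sum_x h x ^+ 2) ->
  \sum_x (\sum_i f (p x i)) ^+ 2 <=
  C * \sum_(e <- undup [seq p x i | x <- enum X, i <- enum I]) f e ^+ 2.
Proof.
move=> f0 C0 HC; set Y := undup _.
have pY x i : p x i \in Y.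
  by rewrite mem_undup; apply/allpairsP; exists (x, i); rewrite !mem_enum.
have uY : uniq Y by exact: undup_uniq.
pose h x := \sum_i f (p x i).
have h0 x : 0 <= h x by exact: sumr_ge0.
pose u e := \sum_x \sum_i h x * (p x i == e)%:R.
have pick (F : E -> R) x i : F (p x i) = \sum_(e <- Y) (p x i == e)%:R * F e.
  rewrite (bigD1_seq (p x i)) //= eqxx mul1r big1 ?addr0 // => e.
  by rewrite eq_sym => /negPf ->; rewrite mul0r.
set S := \sum_x h x ^+ 2; set Z := \sum_(e <- Y) f e ^+ 2.
have SE : S = \sum_(e <- Y) f e * u e.
  transitivity (\sum_x \sum_i \sum_(e <- Y) f e * (h x * (p x i == e)%:R)).
    apply: eq_bigr => x _; rewrite expr2 {2}/h mulr_sumr; apply: eq_bigr => i _.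
    rewrite (pick f) mulr_sumr; apply: eq_bigr => e _; ring.
  under eq_bigr do rewrite exchange_big /=.
  rewrite exchange_big /=; apply: eq_bigr => e _.
  rewrite mulr_sumr; apply: eq_bigr => x _.
  by rewrite mulr_sumr.
have uu : \sum_(e <- Y) u e ^+ 2 =
    \sum_x \sum_y h x * h y * (\sum_i \sum_k (p x i == p y k)%:R).
  transitivity (\sum_x \sum_i h x * u (p x i)).
    transitivity (\sum_x \sum_i \sum_(e <- Y) (h x * (p x i == e)%:R) * u e).
      under [RHS]eq_bigr do rewrite exchange_big /=.
      rewrite [RHS]exchange_big /=; apply: eq_bigr => e _.
      rewrite expr2 {1}/u mulr_suml; apply: eq_bigr => x _.
      by rewrite mulr_suml.
    apply: eq_bigr => x _; apply: eq_bigr => i _.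
    by rewrite (pick u) mulr_sumr; apply: eq_bigr => e _; rewrite mulrA.
  apply: eq_bigr => x _.
  under eq_bigr do rewrite mulr_sumr.
  rewrite exchange_big /=; apply: eq_bigr => y _.
  rewrite [RHS]mulr_sumr; apply: eq_bigr => i _.
  rewrite [RHS]mulr_sumr mulr_sumr; apply: eq_bigr => k _.
  by rewrite mulrA [p y k == _]eq_sym.
have S0 : 0 <= S by apply: sumr_ge0 => x _; exact: sqr_ge0.
have Z0 : 0 <= Z by apply: sumr_ge0 => x _; exact: sqr_ge0.
have [->|Sn0] := eqVneq S 0; first by rewrite mulr_ge0.
have Sgt0 : 0 < S by rewrite lt_def Sn0.
rewrite -(ler_pM2r Sgt0) -expr2 {1}SE.
apply: (le_trans (cauchy_schwarz _ _ _ _)).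
rewrite -/Z uu [C * Z]mulrC -mulrA ler_wpM2l //; exact: HC.
Qed.

Section LatticeMaximal.
Variables (R : realType) (N L M j0 : nat) (kappa : R).
Hypothesis kappa0 : 0 <= kappa.
Hypothesis N0 : (0 < N)%N.
Hypothesis divM : forall d, (0 < d < N)%N -> (d %| M.+1)%N.
Hypothesis ML : (M.+1 <= L)%N.
Hypothesis HK : forall (w : 'I_M.+1 -> 'I_N) (F : 'I_M.+1 -> 'I_M.+1 -> R),
  \sum_z line_sum (w z) F z ^+ 2 <= kappa * M.+1%:R * normsq F.

Definition line_point (j : nat) (x : int * int) (i : 'I_(L.*2.+1)) : int * int :=
  (x.1 + (i%:Z - L%:Z), x.2 + (i%:Z - L%:Z) * (j0 + j)%:Z).

Let C : R := L%:R * (3 + 16 * kappa * (trunc_log 2 N).+1%:R).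

Let C0 : 0 <= C.
Proof. by rewrite mulr_ge0 // addr_ge0 // !mulr_ge0. Qed.

(** Within a slice the first coordinate determines [i], so points of two lines coincide only for
    equal indices. There [j0] cancels, and the kernel is [meetings]. *)
Lemma slice_maximal (T : nat) (a b : int) (j : 'I_T -> 'I_N) (f : int * int -> R) :
  (forall e, 0 <= f e) ->
  \sum_(x < T) (\sum_i f (line_point (j x) (a, b + x%:Z) i)) ^+ 2 <=
  C * \sum_(e <- undup [seq line_point (j x) (a, b + (x : nat)%:Z) i |
                          x <- enum 'I_T, i <- enum 'I_(L.*2.+1)]) f e ^+ 2.
Proof.
move=> f0; apply: (ttstar (p := fun x : 'I_T => line_point (j x) (a, b + x%:Z))) => // h h0.
apply: le_trans (slice_form j h0 kappa0 N0 divM ML HK).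
rewrite le_eqVlt; apply/orP; left; apply/eqP.
apply: eq_bigr => x _; apply: eq_bigr => y _; congr (_ * _).
rewrite /meetings -sum1dep_card natr_sum [RHS]big_mkcond /=; apply: eq_bigr => i _.
rewrite (bigD1 i) //= big1 ?addr0 => [|k ki].
  rewrite /line_point xpair_eqE eqxx /=.
  have -> : (b + x%:Z + (i%:Z - L%:Z) * (j0 + j x)%:Z == b + y%:Z + (i%:Z - L%:Z) * (j0 + j y)%:Z)
     = (x + i * j x + L * j y == y + i * j y + L * j x)%N.
    by apply/eqP/eqP; nia.
  by case: ifP.
rewrite /line_point xpair_eqE /= (inj_eq (addrI _)) (inj_eq (addIr _)) eqz_nat.
by rewrite eq_sym val_eqE (negPf ki).
Qed.

(** The finite set is enlarged to a box and cut into slices. Lines from one slice reach only columns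
    within distance L, so each point is charged by at most 2L + 1 slices. *)
Lemma lattice_maximal (X : seq (int * int)) (J : int * int -> 'I_N)
    (f : int * int -> R) (G : R) : uniq X -> (forall e, 0 <= f e) ->
  (forall Y, uniq Y -> \sum_(y <- Y) f y ^+ 2 <= G) ->
  \sum_(x <- X) (\sum_i f (line_point (J x) x i)) ^+ 2 <= C * L.*2.+1%:R * G.
Proof.
move=> uX f0 fG.
pose B := (\sum_(x <- X) (`|x.1| + `|x.2|))%N; pose T := (B.*2.+1)%N.
pose pt (a b : 'I_T) : int * int := (a%:Z - B%:Z, - B%:Z + b%:Z).
pose box := [seq pt a b | a <- enum 'I_T, b <- enum 'I_T].
have ubox : uniq box.
  rewrite allpairs_uniq ?enum_uniq // => -[a b] [a' b'] _ _ [] /= aa bb.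
  by congr (_, _); apply: val_inj => /=; lia.
have Xbox : {subset X <= box}.
  move=> x xX; have : (`|x.1| + `|x.2| <= B)%N.
    rewrite /B (big_rem x) //=; exact: leq_addr.
  move=> xB.
  have h1 : (absz (x.1 + B%:Z)%R < T)%N by rewrite /T; lia.
  have h2 : (absz (x.2 + B%:Z)%R < T)%N by rewrite /T; lia.
  apply/allpairsP; exists (Ordinal h1, Ordinal h2); rewrite !mem_enum; split => //=.
  by rewrite /pt /=; case: x xX xB h1 h2 => x1 x2 /= *; congr (_, _); lia.
pose S x := (\sum_i f (line_point (J x) x i)) ^+ 2.
have S0 x : 0 <= S x by exact: sqr_ge0.
rewrite (sum_uniq_subset _ uX ubox Xbox).
apply: (@le_trans _ _ (\sum_(x <- box) S x)).
  by rewrite big_mkcond; apply: ler_sum => x _; case: ifP.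
rewrite /box big_allpairs_dep big_enum /=; under eq_bigr do rewrite big_enum /=.
pose Y (a : 'I_T) := undup [seq line_point (J (pt a b)) (pt a b) i |
  b <- enum 'I_T, i <- enum 'I_(L.*2.+1)].
apply: (@le_trans _ _ (\sum_(a < T) C * \sum_(e <- Y a) f e ^+ 2)).
  apply: ler_sum => a _.
  exact: (slice_maximal (a%:Z - B%:Z) (- B%:Z) (fun b => J (pt a b)) f0).
rewrite -mulr_sumr -mulrA ler_wpM2l //.
pose Z := undup (flatten [seq Y a | a <- enum 'I_T]).
have YZ a : {subset Y a <= Z}.
  move=> e eY; rewrite mem_undup; apply/flatten_mapP; exists a => //.
  by rewrite mem_enum.
under eq_bigr => a _ do rewrite (sum_uniq_subset _ (undup_uniq _) (undup_uniq _) (YZ a)).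
rewrite (exchange_big_dep xpredT) //=.
apply: le_trans (ler_wpM2l _ (fG Z (undup_uniq _))) => //.
rewrite mulr_sumr; apply: ler_sum => e _.
rewrite sumr_const -[leLHS]mulr_natl ler_wpM2r ?sqr_ge0 // ler_nat.
rewrite (_ : #|_| = #|[set a : 'I_T | e \in Y a]|); last by rewrite cardsE.
rewrite -[X in (_ <= X)%N](size_iota 0). 
have key (a : 'I_T) : e \in Y a -> exists2 i, (i < L.*2.+1)%N & e.1 + B%:Z + L%:Z - a%:Z = i%:Z.
  rewrite mem_undup => /allpairsP[[b i] [_ _ ->]] /=.
  by exists i => //; lia.
pose F (a : 'I_T) := absz (e.1 + B%:Z + L%:Z - a%:Z)%R.
apply: (@leq_card_seq _ [set a | e \in Y a] F (iota 0 L.*2.+1)) => [a a'|a]; rewrite /F.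
  rewrite !inE => /key[i _ ei] /key[i' _ ei']; rewrite ei ei' !absz_nat => ii.
  by apply: val_inj => /=; lia.
by rewrite inE => /key[i il ->]; rewrite absz_nat mem_iota.
Qed.

End LatticeMaximal.

(** * The directional maximal operator *)

Lemma bump_function_bounded (R : realType) (phi : R -> R) : bump_function phi ->
  exists B D : R, [/\ 0 < B, 1 <= D, forall t, `|phi t| <= B &
    forall t, phi t != 0 -> `|t| <= D].
Proof.
case=> sm K; set S := closure _ in K.
have phi0 t : phi t != 0 -> S t by move=> pt; rewrite /S; apply: subset_closure.
have cont : continuous phi.
  move=> t; apply/differentiable_continuous/derivable1_diffP.
  exact: (sm 0%N t).
have cK : compact (phi @` S)%classic.
  by apply: continuous_compact => //; exact: continuous_subspaceT.
have [D [_ HD]] := compact_bounded K.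
have [B [_ HB]] := compact_bounded cK.
exists (`|B| + 1), (`|D| + 1); split.
- by rewrite ltr_wpDl.
- by rewrite lerDr.
- move=> t; have [->|/phi0 St] := eqVneq (phi t) 0; first by rewrite normr0 addr_ge0.
  by apply: (HB (`|B| + 1)); [rewrite (le_lt_trans (ler_norm _)) // ltrDl|exists t].
- move=> t /phi0 St; apply: (HD (`|D| + 1)) => //.
  by rewrite (le_lt_trans (ler_norm _)) // ltrDl.
Qed.

Lemma normc_ge0 (R : rcfType) (z : R[i]) : 0 <= Normc.normc z.
Proof. by case: z => a b; exact: sqrtr_ge0. Qed.

Lemma normc_real (R : rcfType) (a : R) : Normc.normc a%:C%C = `|a|.
Proof. by rewrite /= expr0n /= addr0 sqrtr_sqr. Qed.

Lemma normc_sum (R : rcfType) (I : Type) (r : seq I) (F : I -> R[i]) :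
  Normc.normc (\sum_(i <- r) F i) <= \sum_(i <- r) Normc.normc (F i).
Proof.
elim: r => [|i r IH]; first by rewrite !big_nil Normc.normc0.
by rewrite !big_cons (le_trans (le_normcD _ _)) // lerD2l.
Qed.

(** Where the kernel is nonzero, |n| <= D 2^k <= L. *)
Lemma directional_average_le (R : realType) (phi : R -> R) (B D : R) (k : int)
    (L j0 j : nat) (f : int * int -> R[i]) (x : int * int) :
  0 <= B -> (forall t, `|phi t| <= B) -> (forall t, phi t != 0 -> `|t| <= D) ->
  D * 2 ^ k <= L%:R ->
  Normc.normc (directional_average phi k (1, (j0 + j)%:Z) f x) <=
  B * 2 ^ (- k) * \sum_i Normc.normc (f (line_point j0 j x (i : 'I_(L.*2.+1)))).
Proof.
move=> B0 phiB phiD DL.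
have t0 : 0 < 2 ^ k :> R by exact: exprz_gt0.
have ti0 : 0 < 2 ^ (- k) :> R by exact: exprz_gt0.
(* The average evaluates [f] at x - n v, so the index [i] of [line_point] corresponds to n = L -
   i. *)
pose e (i : 'I_(L.*2.+1)) : int := L%:Z - i%:Z.
pose r := [seq e i | i <- enum 'I_(L.*2.+1)].
have ur : uniq r.
  rewrite map_inj_uniq ?enum_uniq // => i i'; rewrite /e => ii.
  by apply: val_inj => /=; lia.
rewrite /directional_average (@fsbigE _ _ _ _ _ r) //; last first.
  move=> n _ nr; apply/eqP; rewrite mulf_eq0; apply/orP; right.
  apply: contraR nr => dn.
  have /phiD : phi (2 ^ (- k) * n%:~R) != 0.
    by apply: contra dn => /eqP p0; rewrite /dilate p0 mulr0.
  rewrite normrM gtr0_norm // -ler_pdivlMl // invr_expz opprK mulrC => nD.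
  have {nD} : `|n%:~R : R| <= L%:R by exact: le_trans DL.
  rewrite -intr_norm -[L%:R]/(L%:Z%:~R) ler_int => nL.
  have iL : (absz (L%:Z - n)%R < L.*2.+1)%N by lia.
  apply/mapP; exists (Ordinal iL); first by rewrite mem_enum.
  by rewrite /e /=; lia.
under eq_bigl => n do rewrite in_setT.
apply: (le_trans (normc_sum _ _)).
rewrite big_map big_enum /= mulr_sumr; apply: ler_sum => i _.
rewrite Normc.normcM normc_real mulrC; apply: ler_pM => //; first exact: normc_ge0.
  by rewrite /dilate normrM gtr0_norm // mulrC ler_wpM2r // ltW.
rewrite le_eqVlt; apply/orP; left; apply/eqP; congr (Normc.normc (f _)).
have -> (v : int * int) m : v *~ m = (v.1 * m, v.2 * m).
  have h1 : (v *~ m).1 = v.1 *~ m by exact: (raddfMz fst).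
  have h2 : (v *~ m).2 = v.2 *~ m by exact: (raddfMz snd).
  by rewrite [LHS]surjective_pairing h1 h2 !mulrzz.
rewrite /line_point /e; case: x => x1 x2 /=.
by congr (_, _) => /=; lia.
Qed.

Lemma l2norm_sq_bound (R : realType) (f : int * int -> R[i]) : l2 f ->
  exists G : R, [/\ 0 <= G, l2norm f = (Num.sqrt G)%:E &
    forall Y : seq (int * int), uniq Y -> \sum_(y <- Y) Normc.normc (f y) ^+ 2 <= G].
Proof.
rewrite /l2 /= /l2norm; set E := esum _ _ => fE.
have E0 : (0 <= E)%E.
  by apply: esum_ge0 => x _; rewrite lee_fin sqr_ge0.
have Efin : E \is a fin_num by rewrite -sqrte_fin_num // ge0_fin_numE // sqrte_ge0.
exists (fine E); split; first exact: fine_ge0.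
  by rewrite -{1}(fineK Efin).
move=> Y uY; rewrite -lee_fin fineK // -sumEFin; apply: esum_ge.
exists [set` Y]%classic; first by split => //; exact: finite_seq.
by rewrite -fsbig_seq.
Qed.

Lemma l2norm_le (R : realType) (f : int * int -> R[i]) (G : R) : 0 <= G ->
  (forall Y : seq (int * int), uniq Y -> \sum_(y <- Y) Normc.normc (f y) ^+ 2 <= G) ->
  (l2norm f <= (Num.sqrt G)%:E)%E.
Proof.
move=> G0 fG; rewrite /l2norm -[X in (_ <= X)%E]/(sqrte G%:E) lee_sqrt ?lee_fin //.
apply: ub_ereal_sup => _ [A [finA _] <-].
rewrite fsbig_finite //= sumEFin lee_fin.
by apply: fG; exact: fset_uniq.
Qed.

(** Bernoulli's inequality for (1 + d)^l with 1 + d = 2^theta and 2^l <= N. *)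
Lemma trunc_log_le_powR (R : realType) (theta : R) : 0 < theta ->
  exists K : R, 0 < K /\ forall N : nat, (0 < N)%N ->
    (trunc_log 2 N).+1%:R <= K * N%:R `^ theta.
Proof.
move=> th0; pose d := 2 `^ theta - 1 : R.
have d0 : 0 < d.
  have one : 1 `^ theta = 1 :> R by rewrite powR1.
  rewrite subr_gt0 -[ltLHS]one.
  by rewrite gt0_ltr_powR ?nnegrE // ltr1n.
exists (1 + d^-1); split; first by rewrite addr_gt0 // invr_gt0.
move=> N N0; set l := trunc_log 2 N.
have bern n : 1 + n%:R * d <= (1 + d) ^+ n.
  elim: n => [|n IH]; first by rewrite mul0r addr0 expr0.
  rewrite exprSr; apply: le_trans (ler_wpM2r _ IH); last by rewrite addr_ge0 // ltW.
  rewrite -subr_ge0 -addn1 natrD.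
  have -> : (1 + n%:R * d) * (1 + d) - (1 + (n%:R + 1) * d) = n%:R * d ^+ 2 by ring.
  by rewrite mulr_ge0 ?sqr_ge0.
have lN : 1 + l%:R * d <= N%:R `^ theta.
  apply: (le_trans (bern l)); rewrite /d addrC subrK -powR_mulrn ?powR_ge0 //.
  rewrite -powRrM mulrC powRrM powR_mulrn //.
  rewrite ge0_ler_powR ?nnegrE ?exprn_ge0 ?(ltW th0) //.
  by rewrite -natrX ler_nat trunc_logP.
have K0 : 0 <= 1 + d^-1 by rewrite addr_ge0 // invr_ge0 ltW.
apply: le_trans (ler_wpM2l K0 lN); rewrite -addn1 natrD.
have -> : (1 + d^-1) * (1 + l%:R * d) = l%:R + 1 + (l%:R * d + d^-1).
  by field; rewrite gt_eqF.
by rewrite lerDl addr_ge0 ?invr_ge0 ?mulr_ge0 ?(ltW d0).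
Qed.

Definition consecutive_slopes (N j0 : nat) : {fset int * int} :=
  seq_fset tt [seq (1, (j0 + i)%:Z) | i <- iota 0 N].

Lemma consecutive_slopesP (N j0 : nat) (v : int * int) :
  reflect (exists2 i : 'I_N, true & v = (1, (j0 + i)%:Z)) (v \in consecutive_slopes N j0).
Proof.
rewrite seq_fsetE; apply: (iffP mapP) => [[a]|[a _ ->]].
  by rewrite mem_iota => /andP[_ aN] ->; exists (Ordinal aN).
by exists (a : nat) => //; rewrite mem_iota add0n ltn_ord.
Qed.

Lemma card_consecutive_slopes (N j0 : nat) : #|` consecutive_slopes N j0| = N.
Proof.
rewrite size_seq_fset undup_id ?size_map ?size_iota //.
by rewrite map_inj_uniq ?iota_uniq // => i i' ii; case: ii => ii; lia.
Qed.

Lemma directional_maximal_le (R : realType) (phi : R -> R) (B D : R) (k : int)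
    (N L j0 : nat) (f : int * int -> R[i]) (x : int * int) :
  (0 < N)%N ->
  0 <= B -> (forall t, `|phi t| <= B) -> (forall t, phi t != 0 -> `|t| <= D) ->
  D * 2 ^ k <= L%:R ->
  exists j : 'I_N,
    Normc.normc (directional_maximal phi (consecutive_slopes N j0) k f x) <=
    B * 2 ^ (- k) * \sum_i Normc.normc (f (line_point j0 j x (i : 'I_(L.*2.+1)))).
Proof.
move=> N0 B0 phiB phiD DL.
pose W (j : 'I_N) := \sum_i Normc.normc (f (line_point j0 j x (i : 'I_(L.*2.+1)))).
pose w0 := Ordinal N0; pose j := [arg max_(i > w0) W i]%O.
have jP (i : 'I_N) : W i <= W j.
  by rewrite /j; case: Order.TotalTheory.arg_maxP => // i' _; apply.
have BK : 0 <= B * 2 ^ (- k) by rewrite mulr_ge0 // exprz_ge0.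
exists j; rewrite normc_real; set S := [set _ | _ in _]%classic.
have ubS : ubound S (B * 2 ^ (- k) * W j).
  move=> _ [v vV <-]; have /consecutive_slopesP[i _ ->] : v \in consecutive_slopes N j0 by [].
  apply: (le_trans (directional_average_le _ _ _ _ B0 phiB phiD DL)).
  exact: (ler_wpM2l BK (jP i)).
have Sw : S (Normc.normc (directional_average phi k (1, (j0 + w0)%:Z) f x)).
  by exists (1, (j0 + w0)%:Z) => //; apply/consecutive_slopesP; exists w0.
(* The set of values is nonempty and bounded, so [sup] is a true supremum and not its default
   value. *)
rewrite ger0_norm; first by apply: ge_sup => //; eexists; exact: Sw.
apply: (le_trans (normc_ge0 _)); apply: ub_le_sup Sw.
by exists (B * 2 ^ (- k) * W j).
Qed.

(** With L comparable to D 2^k, the kernel size 2^(-2k) cancels the factor L (2L + 1) of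
    [lattice_maximal]. The squared norm then loses N^theta from the line sums and N^theta from the
    logarithm, hence the norm loses N^theta. *)
Lemma directional_maximal_opnorm (R : realType) (phi : R -> R) (theta : R) :
  bump_function phi -> 0 < theta ->
  exists C : R, 0 < C /\ forall (N j0 : nat) (k : int), (0 < N)%N ->
    (N.-1)`!%:R <= 2 ^ k :> R ->
    (l2_opnorm (directional_maximal phi (consecutive_slopes N j0) k) <=
      (C * N%:R `^ theta)%:E)%E.
Proof.
move=> /bump_function_bounded[B [D [B0 D1 phiB phiD]]] th0.
have [K [K0 HK]] := line_sum_maximal th0.
have [I [I0 HI]] := trunc_log_le_powR th0.
pose c := 12 * B ^+ 2 * D ^+ 2 * (3 + 16 * K * I).
have D0 : 0 < D := lt_le_trans ltr01 D1.
have c0 : 0 <= c by rewrite /c !mulr_ge0 ?sqr_ge0 // ?addr_ge0 ?mulr_ge0 // ltW.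
exists (1 + c); split; first by rewrite ltr_pwDl.
move=> N j0 k N0 Mk.
pose t : R := 2 ^ k; have t0 : 0 < t by exact: exprz_gt0.
(* The period (N - 1)! is divisible by every gap below [N]; the lower bound on 2^k makes it at most
   L. *)
pose M := ((N.-1)`!).-1; have ME : M.+1 = (N.-1)`! by rewrite /M prednK // fact_gt0.
have t1 : 1 <= t by apply: le_trans Mk; rewrite ler1n fact_gt0.
pose L := (Num.truncn (D * t)).+1.
have DtL : D * t <= L%:R by rewrite ltW // truncnS_gt.
have Dt1 : 1 <= D * t by rewrite mulr_ege1.
have LDt : L%:R <= 2 * (D * t).
  rewrite /L -addn1 natrD mulr_natl mulr2n lerD //.
  by have /andP[] := truncn_itv (le_trans ler01 Dt1).
have ML : (M.+1 <= L)%N.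
  rewrite -(ler_nat R) ME; apply: le_trans Mk _; apply: le_trans DtL.
  by rewrite ler_peMl // ltW.
have divM d : (0 < d < N)%N -> (d %| M.+1)%N.
  by move=> /andP[d0 dN]; rewrite ME dvdn_fact // d0 -ltnS prednK.
pose X : R := N%:R `^ theta.
have X1 : 1 <= X by rewrite /X powR_nat_ge1 // ltW.
have X0 : 0 <= X := le_trans ler01 X1.
have kappa0 : 0 <= K * X by rewrite mulr_ge0 // ltW.
have lines (w : 'I_M.+1 -> 'I_N) (F : 'I_M.+1 -> 'I_M.+1 -> R) :
    \sum_z line_sum (w z) F z ^+ 2 <= K * X * M.+1%:R * normsq F.
  have torsion (x : 'I_M.+1) : x *+ M.+1 = 0.
    by rewrite Zp_mulrn; apply: val_inj; rewrite /= modnMl.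
  by have := HK _ M.+1 N isT torsion w F; rewrite card_ord mulrA.
apply: ereal_inf_lbound; exists ((1 + c) * X) => //= f /l2norm_sq_bound[G [G0 -> fG]].
have CX0 : 0 <= (1 + c) * X by rewrite mulr_ge0 // addr_ge0.
rewrite -EFinM -[X in (X * _)%:E](ger0_norm CX0) -sqrtr_sqr -sqrtrM ?sqr_ge0 //.
apply: l2norm_le => [|Y uY]; first by rewrite mulr_ge0 ?sqr_ge0.
have [J HJ] := choice (fun x => directional_maximal_le j0 f x N0 (ltW B0) phiB phiD DtL).
have := lattice_maximal j0 kappa0 N0 divM ML lines J uY (fun e => normc_ge0 (f e)) fG.
set S := \sum_(x <- Y) _ => HS.
apply: (@le_trans _ _ ((B * 2 ^ (- k)) ^+ 2 * S)).
  rewrite mulr_sumr; apply: ler_sum => x _; rewrite -exprMn.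
  rewrite lerXn2r ?nnegrE ?normc_ge0 //.
  by rewrite mulr_ge0 ?sumr_ge0 // => [|*]; rewrite ?normc_ge0 // mulr_ge0 ?exprz_ge0 // ltW.
have -> : 2 ^ (- k) = t^-1 :> R by rewrite -invr_expz.
apply: (le_trans (ler_wpM2l (sqr_ge0 _) HS)).
have L0 : 0 <= L%:R :> R by [].
have lt : t^-1 * L%:R <= 2 * D.
  by rewrite mulrC ler_pdivrMr // -mulrA.
have lt2 : (t^-1) ^+ 2 * (L%:R * L.*2.+1%:R) <= 12 * D ^+ 2.
  have aux (m : nat) : (0 < m -> m.*2.+1 <= 3 * m)%N by clear; lia.
  have L3 : L.*2.+1%:R <= 3 * L%:R :> R by rewrite -natrM ler_nat aux.
  apply: (@le_trans _ _ (3 * (t^-1 * L%:R) ^+ 2)).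
    rewrite exprMn [leRHS]mulrCA ler_wpM2l ?sqr_ge0 // expr2 mulrCA.
    by rewrite ler_wpM2l.
  have -> : 12 * D ^+ 2 = 3 * (2 * D) ^+ 2 by ring.
  rewrite ler_wpM2l // lerXn2r ?nnegrE // ?mulr_ge0 ?invr_ge0 // ltW //.
set l := (trunc_log 2 N).+1%:R; have lI : l <= I * X by exact: HI.
have l0 : 0 <= l by rewrite /l.
have lX : 3 + 16 * (K * X) * l <= (3 + 16 * K * I) * X ^+ 2.
  have X21 : 1 <= X ^+ 2 by rewrite exprn_ege1.
  have -> : (3 + 16 * K * I) * X ^+ 2 = 3 * X ^+ 2 + 16 * (K * X) * (I * X) by ring.
  apply: lerD; first by rewrite ler_peMr.
  by rewrite ler_wpM2l // mulr_ge0.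
apply: (@le_trans _ _ (c * X ^+ 2 * G)).
  have -> : (B * t^-1) ^+ 2 * (L%:R * (3 + 16 * (K * X) * l) * L.*2.+1%:R * G) =
      B ^+ 2 * (((t^-1) ^+ 2 * (L%:R * L.*2.+1%:R)) * (3 + 16 * (K * X) * l)) * G by ring.
  have -> : c * X ^+ 2 * G = B ^+ 2 * ((12 * D ^+ 2) * ((3 + 16 * K * I) * X ^+ 2)) * G.
    by rewrite /c; ring.
  rewrite ler_wpM2r // ler_wpM2l ?sqr_ge0 //.
  have p1 : 0 <= 3 + 16 * (K * X) * l by rewrite addr_ge0 // !mulr_ge0 // ltW.
  have p2 : 0 <= t^-1 ^+ 2 * (L%:R * L.*2.+1%:R) by rewrite mulr_ge0 ?sqr_ge0 // mulr_ge0.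
  exact: ler_pM.
rewrite ler_wpM2r // exprMn ler_wpM2r ?sqr_ge0 //.
(* Here c <= (1 + c)^2, so 1 + c serves in place of the square root of c. *)
by have := sqr_ge0 c; rewrite sqrrD; lra.
Qed.

Theorem theorem1p4 (R : realType) :
  exists c1 c2 : R, 0 < c1 /\ c1 < c2 /\
  forall phi : R -> R, bump_function phi ->
  forall eps : R, 0 < eps ->
  exists Ceps C0 : R, 0 < Ceps /\ 0 < C0 /\
  exists C1 : R -> R, (forall A : R, 0 < C1 A) /\
  forall N : nat, (0 < N)%N ->
  forall A : R, N%:R `^ C0 <= A ->
  exists V : {fset (int * int)},
    (forall z : int * int, z \in V -> c1 * A <= Z2norm R z <= c2 * A) /\
    #|` V| = N /\
    forall k : int, N%:R `^ (C1 A) <= 2 ^ k ->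
      (l2_opnorm (directional_maximal phi V k) <= (Ceps * N%:R `^ eps)%:E)%E.
Proof.
exists 1, 4; split => //; split; first by lra.
move=> phi bphi eps eps0.
have [C [C0 HC]] := directional_maximal_opnorm bphi eps0.
exists C, 1; split => //; split => //.
(* As N <= A, the factorial of the integer part of [A] dominates (N - 1)!. *)
exists (fun A => (Num.truncn A)`!%:R); split; first by move=> A; rewrite ltr0n fact_gt0.
move=> N N0 A; rewrite powRr1 // => NA.
have A1 : 1 <= A by apply: le_trans NA; rewrite ler1n.
(* Slopes lie between A and 2A + 1, and 1 + (2A + 1)^2 <= 16 A^2 for A >= 1, whence the constants 1
   and 4. *)
pose j0 := (Num.truncn A).+1.
have Aj0 : A <= j0%:R by rewrite ltW // truncnS_gt.
have j0A : j0%:R <= A + 1.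
  rewrite /j0 -addn1 natrD lerD2r.
  by have /andP[] := truncn_itv (le_trans ler01 A1).
exists (consecutive_slopes N j0); split; last split.
- move=> z /consecutive_slopesP[a _ ->].
  have aN : (a : nat)%:R <= A.
    by apply: le_trans NA; rewrite ler_nat ltnW.
  have a0 : 0 <= (a : nat)%:R :> R by [].
  rewrite /Z2norm /= mul1r -[(_ + _)%N%:~R]/((j0 + a)%:R : R) natrD.
  move: (a : nat)%:R j0%:R aN a0 Aj0 j0A => u v *.
  apply/andP; split.
    rewrite -[leLHS]ger0_norm ?(le_trans ler01) // -sqrtr_sqr ler_wsqrtr //.
    by nra.
  rewrite -[leRHS]ger0_norm -?sqrtr_sqr ?ler_wsqrtr //; last by lra.
  by nra.
- exact: card_consecutive_slopes.
move=> k Nk; apply: HC => //; apply: le_trans Nk.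
(* For N = 1 the power N^C1 stays equal to 1, which is 0!; for N >= 2 one has N^m > m >= (N -
   1)!. *)
have [N1|N1] := leqP N 1.
  have -> : N = 1%N by lia.
  by rewrite powR1.
pose m := (Num.truncn A)`!.
have Nm : ((N.-1)`! <= m)%N.
  have : (N.-1 <= Num.truncn A)%N by rewrite ltnW // truncn_gt_nat prednK.
  exact: leq_fact.
rewrite -/m powR_mulrn // -natrX ler_nat (leq_trans Nm) //.
exact: ltnW (ltn_expl m N1).
Qed.
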